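(* For every integer $t$ with $t \geq 2$, for every graph $X$ with $\operatorname{td}(X) \leq t$, there exists an integer $c$ such that for every graph $G$, if $G$ is $X$-minor-free, then for every integer $r$ with $r \geq 2$, \[ \operatorname{wcol}_r(G) \leq c \cdot (\operatorname{tw}(G)+1) \cdot r^{t-2} \log r. \]
   Context: For a graph $G$, an ordering $\sigma$ of $V(G)$, a nonnegative integer $r$ and a vertex $u$, a vertex $v$ is weakly $r$-reachable from $u$ in $(G,\sigma)$ if there is a $u$–$v$ path in $G$ with at most $r$ edges all of whose vertices $w$ satisfy $v \leq_\sigma w$; $\operatorname{WReach}_r[G,\sigma,u]$ denotes the set of such $v$, and $\operatorname{wcol}_r(G)=\min_{\sigma}\max_{u\in V(G)}|\operatorname{WReach}_r[G,\sigma,u]|$. $\operatorname{td}$ denotes treedepth (0 for the null graph, $\min_v \operatorname{td}(X-v)+1$ for connected $X$, maximum over components otherwise) and $\operatorname{tw}$ denotes treewidth. *)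

(* Defs.v *)
From HB Require Import structures.
From mathcomp Require Import all_boot all_order all_algebra.
From mathcomp Require Import boolp reals exp.

Set Implicit Arguments.
Unset Strict Implicit.
Unset Printing Implicit Defensive.

(** Graphs are finite and simple; the null graph is allowed. *)
Record sgraph := SGraph {
  vertex :> finType;
  edge : rel vertex;
  edge_sym : symmetric edge;
  edge_irrefl : irreflexive edge }.

Section Connectivity.
Variable G : sgraph.
Implicit Types (A : {set G}) (x y : G).

Definition edge_in A : rel G := [rel x y | [&& x \in A, y \in A & edge x y]].

(** [G[A]] is connected; the null graph does not count as connected. *)
Definition connected_set A : bool :=
  (A != set0) && [forall x in A, forall y in A, connect (edge_in A) x y].

Definition component_of A x : {set G} :=
  [set y in A | connect (edge_in A) x y].

Definition components A : {set {set G}} := [set component_of A x | x in A].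

End Connectivity.

Section WeakColoring.
Variables (G : sgraph) (r : nat).

(** An ordering of V(G) is a duplicate-free tuple [s] listing all the
    vertices, and [v] precedes [w] when [index v s <= index w s]. *)
Definition weakly_reachable (s : #|G|.-tuple G) (u v : G) : bool :=
  [exists n : 'I_r.+1, exists p : n.-tuple G,
    [&& path (@edge G) u p, uniq (u :: p), last u p == v &
        all (fun w => index v s <= index w s) (u :: p)]].

Definition WReach (s : #|G|.-tuple G) (u : G) : {set G} :=
  [set v | weakly_reachable s u v].

Definition wcol_ord (s : #|G|.-tuple G) : nat := \max_(u : G) #|WReach s u|.

Definition wcol : nat :=
  wcol_ord [arg min_(s < enum_tuple G | uniq s) wcol_ord s].

End WeakColoring.

Section Treedepth.
Variable G : sgraph.
Implicit Types A C : {set G}.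

(** Treedepth of the induced subgraph [G[A]]. The first argument is fuel:
    [#|A|] is enough, since both recursive calls are on smaller sets. See
    [td_set0], [td_connected] and [td_disconnected] for the recursion. *)
Fixpoint td_rec (n : nat) A : nat :=
  if n isn't m.+1 then 0 else
  if [pick x in A] isn't Some x then 0 else
  if connected_set A
  then (td_rec m (A :\ [arg min_(v < x in A) td_rec m (A :\ v)])).+1
  else \max_(C in components A) td_rec m C.

Definition td_in A : nat := td_rec #|A| A.

Definition td : nat := td_in [set: G].

Lemma component_proper A C :
  A != set0 -> ~~ connected_set A -> C \in components A -> #|C| < #|A|.
Proof.
move=> A0; rewrite /connected_set A0 /= => nc /imsetP[x xA ->].
rewrite proper_card // properEneq; apply/andP; split; last first.
  by apply/subsetP => y; rewrite inE => /andP[].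
apply: contra nc => /eqP eA.
have symA : connect_sym (edge_in A).
  apply: sym_connect_sym => a b; rewrite /edge_in /= edge_sym.
  by rewrite !andbA [(a \in A) && _]andbC.
have cx y : y \in A -> connect (edge_in A) x y by rewrite -{1}eA inE => /andP[].
apply/forall_inP => y yA; apply/forall_inP => z zA.
by apply: connect_trans (cx z zA); rewrite symA cx.
Qed.

Lemma td_rec_fuel n A : #|A| <= n -> td_rec n A = td_in A.
Proof.
suff eq_fuel m : #|A| <= m -> #|A| <= n -> td_rec n A = td_rec m A.
  exact: eq_fuel.
elim: n m A => [|n IHn] [|m] A //=.
- by move=> _ /[!leqn0] /eqP/cards0_eq ->; case: pickP => // x; rewrite inE.
- by move=> /[!leqn0] /eqP/cards0_eq -> _; case: pickP => // x; rewrite inE.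
move=> Am An; case: pickP => // x xA.
have eqD v : v \in A -> td_rec n (A :\ v) = td_rec m (A :\ v).
  move=> vA; have ltA : #|A :\ v| < #|A| by rewrite [X in _ < X](cardsD1 v) vA.
  by apply: IHn; rewrite -ltnS (leq_trans ltA).
case: ifPn => [_|nc].
  case: arg_minnP => // v vA minv; case: arg_minnP => // w wA minw.
  congr _.+1; apply/eqP; rewrite eqn_leq -{1}(eqD w wA) minv //=.
  by rewrite (eqD v vA) minw.
have A0 : A != set0 by apply/set0Pn; exists x.
apply: eq_bigr => C CA; have ltC := component_proper A0 nc CA.
by apply: IHn; rewrite -ltnS (leq_trans ltC).
Qed.

Lemma td_set0 : td_in set0 = 0.
Proof. by rewrite /td_in cards0. Qed.

Lemma td_connected A : connected_set A ->
  (exists2 v, v \in A & td_in A = (td_in (A :\ v)).+1) /\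
  (forall v, v \in A -> td_in A <= (td_in (A :\ v)).+1).
Proof.
move=> cA; have /andP[/set0Pn[x0 x0A] _] := cA.
have cardA v : v \in A -> #|A :\ v| <= #|A|.-1.
  by move=> vA; rewrite (cardsD1 v A) vA.
have -> : td_in A = td_rec #|A|.-1.+1 A.
  by rewrite td_rec_fuel // prednK //; apply/card_gt0P; exists x0.
rewrite /= cA; case: pickP => [x xA|/(_ x0)]; last by rewrite x0A.
case: arg_minnP => // v vA minv; split.
  by exists v; rewrite // td_rec_fuel ?cardA.
by move=> w wA; rewrite ltnS -(td_rec_fuel (cardA w wA)) minv.
Qed.

Lemma td_disconnected A : A != set0 -> ~~ connected_set A ->
  td_in A = \max_(C in components A) td_in C.
Proof.
move=> A0 nc; have /set0Pn[x0 x0A] := A0.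
have -> : td_in A = td_rec #|A|.-1.+1 A.
  by rewrite td_rec_fuel // prednK //; apply/card_gt0P; exists x0.
rewrite /= (negbTE nc); case: pickP => [x xA|/(_ x0)]; last by rewrite x0A.
apply: eq_bigr => C CA; apply: td_rec_fuel.
by have := component_proper A0 nc CA; case: #|A|.
Qed.

End Treedepth.

(** [B] is a model of [X] in [G], with branch sets [B x]. *)
Definition minor_model (X G : sgraph) (B : X -> {set G}) : Prop :=
  [/\ forall x, connected_set (B x),
      forall x y, x != y -> [disjoint B x & B y] &
      forall x y, edge x y ->
        exists a b, [/\ a \in B x, b \in B y & edge a b]].

Definition is_minor (X G : sgraph) : Prop :=
  exists B : X -> {set G}, minor_model B.

Definition minor_free (X G : sgraph) : Prop := ~ is_minor X G.

Definition is_tree (T : sgraph) : Prop :=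
  connected_set [set: T] /\
  forall c : seq T, 2 < size c -> ~~ ucycleb (@edge T) c.

(** As [connected_set] excludes the empty set, the second condition includes
    that every vertex lies in some bag. *)
Definition tree_decomposition (G T : sgraph) (W : T -> {set G}) : Prop :=
  [/\ is_tree T,
      forall v : G, connected_set [set x : T | v \in W x] &
      forall u v : G, edge u v -> exists x : T, (u \in W x) && (v \in W x)].

Definition has_tree_decomposition (G : sgraph) (k : nat) : bool :=
  `[< exists T : sgraph, exists W : T -> {set G},
        tree_decomposition W /\ \max_(x : T) #|W x| = k >].

Lemma has_tree_decomposition_ex (G : sgraph) :
  exists k, has_tree_decomposition G k.
Proof.
pose T := @SGraph unit (fun _ _ => false) (fun _ _ => erefl) (fun _ => erefl).
exists (\max_(x : T) #|[set: G]|); apply/asboolP.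
have conn (A : {set T}) : tt \in A -> connected_set A.
  move=> ttA; apply/andP; split; first by apply/set0Pn; exists tt.
  by apply/forall_inP => -[] _; apply/forall_inP => -[].
exists T, (fun=> [set: G]); split=> //; split.
- split; first exact: conn.
  by case=> [|[] [|[] c]].
- by move=> v; apply: conn; rewrite !inE.
- by move=> u v _; exists tt; rewrite !inE.
Qed.

(** The width is the maximum bag size minus one; the null graph has
    treewidth -1, which is why [tw] is integer valued. *)
Definition tw (G : sgraph) : int :=
  ((ex_minn (has_tree_decomposition_ex G))%:Z - 1)%R.

(* Main.v *)
Require Import Defs.
From mathcomp Require Import all_boot all_order all_algebra.
From mathcomp Require Import boolp reals exp zify ring lra.

Set Implicit Arguments.
Unset Strict Implicit.
Unset Printing Implicit Defensive.

(** Let [U_h] be the closure of the complete [d]-ary tree with [h] levels; a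
    graph [X] of treedepth at most [t] is a subgraph of [#|X|] disjoint copies
    of [U_t] with [d = #|X|]. By induction on [h >= 2], for every upward closed
    family [F] of sets such that [K] has no [n] disjoint models of [U_h] with
    all branch sets in [F], there is a set [S] meeting every connected member
    of [F] inside [K], and an order for which every vertex weakly reaches
    [O((tw + 1) r^(h-2) log r)] vertices of [S].
    With [F] containing all singletons this gives the theorem.

    From [n] copies to one copy: by the Erdos-Posa property of connected sets
    in a tree decomposition, [n * (tw + 1)] vertices meet all connected sets
    containing a model of [U_h]; treat the remaining components separately.

    From [U_(h+1)] to copies of [U_h]: let [R] be a connected set and [K] a
    component of the rest. Inside [K] the members of [F] adjacent to [R] do
    not form [d + 1] copies of [U_h], as [R] could serve as the root; so some
    [S] from the induction hypothesis separates [R] from everything still to be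
    met. Repeating this in the parts left behind [S] gives nested levels, and a
    walk between two levels crosses all those in between. Hence at most
    [r + O(1)] levels are reached. When [h = 1], [S] comes directly from the
    Erdos-Posa property, and the nested parts contain at most [d] disjoint
    branches; so the levels form boundedly many chains, on each of which the
    ruler order of the levels reaches only [O(log r)] of them.

    Weak reachability is measured by the number of visits to [S] instead of
    the length of the path. This stronger bound survives the removal from [S]
    of the vertices that are hidden behind a component of [K - S]. *)

(** * Connected sets *)

Section ConnectedSets.
Variable G : sgraph.
Implicit Types (A B C D K M R : {set G}) (x y z : G).

Definition touch R A : bool := [exists x in R, exists y in A, edge x y].

Lemma touchP R A :
  reflect (exists x y, [/\ x \in R, y \in A & edge x y]) (touch R A).
Proof.
apply: (iffP exists_inP) => [[x xR /exists_inP[y yA xy]]|[x [y [xR yA xy]]]].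
  by exists x, y.
by exists x => //; apply/exists_inP; exists y.
Qed.

Lemma touch_sub R R' A A' :
  R \subset R' -> A \subset A' -> touch R A -> touch R' A'.
Proof.
move=> /subsetP RR' /subsetP AA' /touchP[x [y [xR yA xy]]].
by apply/touchP; exists x, y; split; auto.
Qed.

Lemma connect_edge_in_sym A : connect_sym (edge_in A).
Proof.
apply: sym_connect_sym => x y; rewrite /edge_in /= edge_sym.
by rewrite !andbA [(x \in A) && _]andbC.
Qed.

Lemma connect_edge_in_sub A B x y : A \subset B ->
  connect (edge_in A) x y -> connect (edge_in B) x y.
Proof.
move=> /subsetP AB; apply: connect_sub => {}x {}y /and3P[xA yA xy].
by apply: connect1; rewrite /edge_in /= !AB.
Qed.

Lemma connect_edge_in_closed A x y (P : pred G) :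
  (forall z z', z \in A -> z' \in A -> edge z z' -> P z -> P z') ->
  connect (edge_in A) x y -> P x -> P y.
Proof.
move=> clos /connectP[p pth ->]; elim: p x pth => //= z p IH x.
by move=> /andP[/and3P[xA zA xz] pth] Px; apply: IH pth (clos _ _ xA zA xz Px).
Qed.

Lemma connected_set_from A x : x \in A ->
  (forall y, y \in A -> connect (edge_in A) x y) -> connected_set A.
Proof.
move=> xA cx; apply/andP; split; first by apply/set0Pn; exists x.
apply/forall_inP => y yA; apply/forall_inP => z zA.
by apply: connect_trans (cx z zA); rewrite connect_edge_in_sym cx.
Qed.

Lemma connected_connect A x y :
  connected_set A -> x \in A -> y \in A -> connect (edge_in A) x y.
Proof. by move=> /andP[_ /forall_inP cA] xA yA; apply: (forall_inP (cA x xA)). Qed.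

Lemma connected_nonempty A : connected_set A -> exists x, x \in A.
Proof. by move=> /andP[/set0Pn]. Qed.

Lemma connected_set1 x : connected_set [set x].
Proof.
by apply: (@connected_set_from _ x); rewrite ?inE // => y /set1P ->.
Qed.

Lemma connected_setU A B : connected_set A -> connected_set B ->
  touch A B -> connected_set (A :|: B).
Proof.
move=> cA cB /touchP[x [y [xA yB xy]]].
apply: (@connected_set_from _ x); first by rewrite inE xA.
move=> z /setUP[zA|zB].
  by apply: connect_edge_in_sub (connected_connect cA xA zA); apply: subsetUl.
apply: (@connect_trans _ _ y); last first.
  by apply: connect_edge_in_sub (connected_connect cB yB zB); apply: subsetUr.
by apply: connect1; rewrite /edge_in /= !inE xA yB orbT.
Qed.

Lemma connected_setU_points A B : connected_set A ->
  (forall y, y \in B -> touch A [set y]) -> connected_set (A :|: B).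
Proof.
move=> cA tB; have [x xA] := connected_nonempty cA.
apply: (@connected_set_from _ x); first by rewrite inE xA.
have sA := subsetUl A B.
move=> y /setUP[yA|yB]; first by apply: connect_edge_in_sub sA _; apply: connected_connect.
have /touchP[z [_ [zA /set1P -> zy]]] := tB y yB.
apply: (@connect_trans _ _ z).
  by apply: connect_edge_in_sub sA _; apply: connected_connect.
by apply: connect1; rewrite /edge_in /= !inE zA yB orbT.
Qed.

Lemma connected_cross A C : connected_set A -> (exists2 x, x \in A & x \in C) ->
  ~~ (A \subset C) ->
  exists x y, [/\ x \in A, x \in C, y \in A, y \notin C & edge x y].
Proof.
move=> cA [x xA xC] /subsetPn[y yA yC].
apply: contrapT => noC; move/negP: yC; apply.
apply: (connect_edge_in_closed (P := mem C)) (connected_connect cA xA yA) xC.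
move=> z z' zA z'A zz' zC; apply: contrapT => /negP z'C; apply: noC.
by exists z, z'; split.
Qed.

Lemma connected_touch_setD K M : connected_set M -> K \subset M ->
  K != set0 -> K != M -> touch (M :\: K) K.
Proof.
move=> cM KM /set0Pn[x xK] KneM.
have [||y [z [yM yK zM zK yz]]] := connected_cross (C := K) cM.
- by exists x => //; apply: (subsetP KM).
- by apply: contra KneM => MK; rewrite eqEsubset KM.
by apply/touchP; exists z, y; rewrite inE zK zM edge_sym; split.
Qed.

Lemma component_of_sub A x : component_of A x \subset A.
Proof. by apply/subsetP => y; rewrite inE => /andP[]. Qed.

Lemma mem_component_of A x : x \in A -> x \in component_of A x.
Proof. by rewrite inE => ->; rewrite connect0. Qed.

Lemma mem_components A x : x \in A -> component_of A x \in components A.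
Proof. by move=> xA; apply/imsetP; exists x. Qed.

Lemma component_of_edge A x y z :
  y \in component_of A x -> z \in A -> edge y z -> z \in component_of A x.
Proof.
rewrite !inE => /andP[yA xy] zA yz; rewrite zA /=.
by apply: connect_trans xy (connect1 _); rewrite /edge_in /= yA zA yz.
Qed.

Lemma component_of_connected A x : x \in A -> connected_set (component_of A x).
Proof.
move=> xA; have xC := mem_component_of xA.
apply: (@connected_set_from _ x) => // y; rewrite inE => /andP[yA xy].
suff: (y \in component_of A x) && connect (edge_in (component_of A x)) x y.
  by case/andP.
apply: (connect_edge_in_closed
  (P := fun y => (y \in component_of A x) && connect (edge_in (component_of A x)) x y))
  xy _; last by rewrite xC connect0.
move=> z z' zA z'A zz' /andP[zC xz]; have z'C := component_of_edge zC z'A zz'.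
by rewrite z'C (connect_trans xz) // connect1 // /edge_in /= zC z'C.
Qed.

Lemma connected_sub_component A B x : connected_set B -> B \subset A ->
  (exists2 y, y \in B & y \in component_of A x) -> B \subset component_of A x.
Proof.
move=> cB BA [y yB yC]; apply: contrapT => /negP nsub.
have [|z [z' [zB zC z'B /negP z'C zz']]] := connected_cross cB _ nsub.
  by exists y.
by apply: z'C; apply: component_of_edge zC (subsetP BA _ z'B) zz'.
Qed.

Lemma components_connected A C : C \in components A -> connected_set C.
Proof. by move=> /imsetP[x xA ->]; apply: component_of_connected. Qed.

Lemma components_sub A C : C \in components A -> C \subset A.
Proof. by move=> /imsetP[x xA ->]; apply: component_of_sub. Qed.

Lemma connected_sub_components A B C : connected_set B -> B \subset A ->
  C \in components A -> (exists2 y, y \in B & y \in C) -> B \subset C.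
Proof. by move=> cB BA /imsetP[x _ ->]; apply: connected_sub_component. Qed.

Lemma components_eq A C D x : C \in components A -> D \in components A ->
  x \in C -> x \in D -> C = D.
Proof.
move=> CA DA xC xD; apply/eqP; rewrite eqEsubset; apply/andP; split.
  apply: (connected_sub_components (components_connected CA) (components_sub CA) DA).
  by exists x.
apply: (connected_sub_components (components_connected DA) (components_sub DA) CA).
by exists x.
Qed.

Lemma components_edge A C x y :
  C \in components A -> x \in C -> y \in A -> edge x y -> y \in C.
Proof. by move=> /imsetP[z zA ->]; apply: component_of_edge. Qed.

Lemma connected_in_component A B : connected_set B -> B \subset A ->
  exists2 C, C \in components A & B \subset C.
Proof.
move=> cB BA; have [x xB] := connected_nonempty cB.
have xA := subsetP BA _ xB; exists (component_of A x); first exact: mem_components.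
by apply: connected_sub_component => //; exists x => //; apply: mem_component_of.
Qed.

(** As [M] is connected, each component of [M :\: C] other than the removed one has an edge to [C],
    which holds together all that is left. *)
Lemma connected_setD_component M C x : connected_set M -> connected_set C ->
  C \subset M -> connected_set (M :\: component_of (M :\: C) x).
Proof.
move=> cM cC CM; set D := component_of _ _; have [c cinC] := connected_nonempty cC.
have CD : C \subset M :\: D.
  apply/subsetP => y yC; rewrite inE (subsetP CM) // andbT.
  by apply: contraL yC => /(subsetP (component_of_sub _ _)) /setDP[].
apply: (@connected_set_from _ c); first exact: (subsetP CD).
move=> y /setDP[yM yD]; have [yC|yC] := boolP (y \in C).
  by apply: connect_edge_in_sub CD _; apply: connected_connect.
have yMC : y \in M :\: C by rewrite inE yC.
pose E := component_of (M :\: C) y; have yE : y \in E := mem_component_of yMC.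
have cE : connected_set E := component_of_connected yMC.
have EMC : E \subset M :\: C := component_of_sub _ _.
have ED : E \subset M :\: D.
  apply/subsetP => z zE; have zMC := subsetP EMC _ zE.
  rewrite inE; have /setDP[-> _] := zMC; rewrite andbT; apply: contra yD => zD.
  have: E \subset D by apply: connected_sub_component => //; exists z.
  by move/subsetP; apply.
have [||a [b [aM aE bM bE ab]]] := connected_cross (C := E) cM.
- by exists y.
- by apply/subsetPn; exists c; [apply: (subsetP CM)|
    apply/negP => /(subsetP EMC) /setDP[_ /negP]].
have bC : b \in C.
  apply: contrapT => /negP nbC; move/negP: bE; apply.
  by apply: (component_of_edge aE) ab; rewrite inE nbC.
apply: (@connect_trans _ _ b).
  by apply: connect_edge_in_sub CD _; apply: connected_connect.
apply: (@connect_trans _ _ a); last first.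
  by apply: connect_edge_in_sub ED _; apply: connected_connect.
apply: connect1; rewrite /edge_in /= (subsetP CD) // (subsetP ED) //=.
by rewrite edge_sym.
Qed.

End ConnectedSets.

(** * Packing and covering connected sets in a tree decomposition *)

Definition disjoint_family (T : finType) (s : seq {set T}) : bool :=
  pairwise (fun A B : {set T} => [disjoint A & B]) s.

(** [dep] is the distance from [r0]; the last edge of a shortest walk leads to a closer
    neighbour. *)
Lemma connected_root_depth (T : sgraph) : connected_set [set: T] ->
  exists (r0 : T) (dep : T -> nat),
    forall x, x != r0 -> exists2 p, edge x p & dep p < dep x.
Proof.
move=> cT; have [r0 _] := connected_nonempty cT.
pose P x n := [exists q : n.-tuple T, path (@edge T) r0 q && (last r0 q == x)].
have exP x : exists n, P x n.
  have /connectP[q pq lq] := connected_connect cT (in_setT r0) (in_setT x).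
  exists (size q); apply/existsP; exists (in_tuple q); rewrite /= -lq eqxx andbT.
  by apply: sub_path pq => a b /and3P[].
exists r0, (fun x => ex_minn (exP x)) => x xr0.
case: (ex_minnP (exP x)) => n /existsP[[q /= /eqP sq] /andP[pq /eqP lq]] _.
case/lastP: q sq pq lq => [|q y] /=; first by move=> _ _ e; rewrite e eqxx in xr0.
rewrite size_rcons rcons_path last_rcons => <- /andP[pq eqy] <-.
exists (last r0 q); first by rewrite edge_sym.
case: ex_minnP => m _ /(_ (size q)); apply.
by apply/existsP; exists (in_tuple q); rewrite /= pq eqxx.
Qed.

(** A path from [p] to [y] avoiding [x] closes to a cycle through [x], and [p != y] gives it at
    least three vertices. *)
Lemma tree_cut (T : sgraph) (x p y : T) : is_tree T ->
  edge x p -> edge x y -> p != y -> ~~ connect (edge_in [set~ x]) p y.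
Proof.
move=> [_ acyclic] xp xy py; apply/negP => /connectP[q0 pq0 lq0].
move: lq0; case: (shortenP pq0) => q pq uq _ lq.
have pq' : path (@edge T) p q by apply: sub_path pq => a b /and3P[].
have nx : x \notin p :: q.
  apply/negP; rewrite inE => /orP[/eqP e|].
    by move: xp; rewrite -e edge_irrefl.
  elim: q p {uq lq pq' xp py pq0} pq => //= a q IH p /andP[/and3P[_ ax _] pa].
  by rewrite inE => /orP[/eqP e|]; [move: ax; rewrite -e !inE eqxx|apply: IH pa].
have/negP sz : ~~ ucycleb (@edge T) (x :: p :: q); last apply: sz.
  apply: acyclic.
  by case: q lq {pq uq pq' nx} => //= e; rewrite e eqxx in py.
rewrite /ucycleb /= xp rcons_path pq' -lq edge_sym xy /=.
by move: uq; rewrite /= nx => ->.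
Qed.

Section ErdosPosa.
Variables (G T : sgraph) (W : T -> {set G}) (w : nat).
Hypotheses (tdW : tree_decomposition W) (bagW : forall x, #|W x| <= w).

Implicit Types B : {set G}.

Let trace B : {set T} := [set x | ~~ [disjoint W x & B]].

Let mem_trace B x v : v \in W x -> v \in B -> x \in trace B.
Proof. by move=> vW vB; rewrite inE; apply/pred0Pn; exists v; rewrite /= vW. Qed.

(** The bags at one vertex are connected in [T] and adjacent vertices share a bag, so the bags met
    along a path of [B] hang together. *)
Let connected_trace B : connected_set B -> connected_set (trace B).
Proof.
move=> cB; have [_ cW eW] := tdW; have [u uB] := connected_nonempty cB.
have [x /[!inE] uWx] := connected_nonempty (cW u).
have one v y y' : v \in B -> v \in W y -> v \in W y' -> connect (edge_in (trace B)) y y'.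
  move=> vB vy vy'; have sub : [set z | v \in W z] \subset trace B.
    by apply/subsetP => z; rewrite inE => vz; apply: mem_trace vz vB.
  by apply: connect_edge_in_sub sub _; apply: connected_connect; rewrite ?inE.
apply: (@connected_set_from _ _ x); first exact: mem_trace uWx uB.
move=> y; rewrite inE => /pred0Pn[v /andP[/= vWy vB]].
pose P v := [forall y, (v \in W y) ==> connect (edge_in (trace B)) x y].
suff: P v by move/forallP/(_ y)/implyP; apply.
apply: (connect_edge_in_closed (P := P)) (connected_connect cB uB vB) _.
  move=> a b aB bB /eW[z /andP[aWz bWz]] /forallP Pa; apply/forallP => z'.
  apply/implyP => bWz'; apply: (@connect_trans _ _ z).
    by have /implyP := Pa z; apply.
  exact: one bB bWz bWz'.
by apply/forallP => z; apply/implyP => uWz; apply: one uB uWx uWz.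
Qed.

(* The bag separating the rest is the topmost bag met by [B], for a member [B]
   whose topmost bag is as deep as possible. *)
Let deepest_member (H : {set G} -> Prop) B0 :
  (forall B, H B -> connected_set B) -> H B0 ->
  exists B x, H B /\
    forall B', H B' -> [disjoint B' & W x] -> [disjoint B & B'].
Proof.
move=> cH HB0; have [treeT _ _] := tdW; have [cT _] := treeT.
have [r0 [dep depP]] := connected_root_depth cT.
pose top (B : {set G}) x := (x \in trace B) && [forall y in trace B, dep x <= dep y].
have topE B : H B -> exists x, top B x.
  move=> /cH/connected_trace/connected_nonempty[x xB].
  case: (@arg_minnP _ x (mem (trace B)) dep) => // y yB ymin.
  by exists y; apply/andP; split => //; apply/forall_inP.
pose Q (p : {set G} * T) := `[< H p.1 >] && top p.1 p.2.
have [x0 tx0] := topE _ HB0.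
have Q0 : Q (B0, x0) by rewrite /Q /= tx0 andbT; apply/asboolP.
case: (@arg_maxnP _ (B0, x0) Q (fun p => dep p.2) Q0) => -[B x].
move=> /andP[/= /asboolP HB /andP[xB /forall_inP xmin]] deepest.
exists B, x; split=> // B' HB' dB'x; apply/pred0P => v /=; apply/negP.
move=> /andP[vB vB'].
have [z tz] := topE _ HB'; have /andP[zB' _] := tz.
have zx : dep z <= dep x by apply: (deepest (B', z)); rewrite /Q /= tz andbT; apply/asboolP.
have [_ cW _] := tdW; have [y /[!inE] vWy] := connected_nonempty (cW v).
have yB : y \in trace B := mem_trace vWy vB.
have yB' : y \in trace B' := mem_trace vWy vB'.
have xB' : x \notin trace B' by rewrite inE negbK disjoint_sym.
have B'x : trace B' \subset [set~ x].
  by apply/subsetP => a aB'; rewrite !inE; apply: contraNneq xB' => <-.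
have yx : y \in [set~ x] := subsetP B'x _ yB'.
(* [B'] misses the bag at [x], so its trace lies in one component [C] of the tree without [x]; [B]
   enters [C] through a neighbour [a] of [x] with [dep x <= dep a]. *)
pose C := component_of [set~ x] y.
have zC : z \in C.
  rewrite inE (subsetP B'x) //=; apply: connect_edge_in_sub B'x _.
  exact: connected_connect (connected_trace (cH _ HB')) yB' zB'.
have xC : x \notin C by apply/negP => /(subsetP (component_of_sub _ _)); rewrite !inE eqxx.
have [||a [b [aB aC bB bC ab]]] := connected_cross (C := C) (connected_trace (cH _ HB)).
- by exists y; rewrite ?mem_component_of.
- by apply/subsetPn; exists x.
have {bC}bx : b = x.
  apply/eqP; apply: contrapT => /negP bx; move/negP: bC; apply.
  by apply: component_of_edge aC _ ab; rewrite !inE.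
subst b; have xa := xmin _ aB.
(* Decreasing the depth leads to [r0] without meeting [x]. From the top [z] of [B'] this puts [r0]
   in [C], and from a neighbour [p] of [x] closer to the root it puts [p] in [C]. Then [p] and [a]
   contradict [tree_cut]. *)
have down m c : dep c <= m -> c != x -> dep c <= dep x ->
    r0 != x /\ connect (edge_in [set~ x]) c r0.
  elim: m c => [|m IH] c.
    move=> c0 cx _; have [<-|/depP[p _]] := eqVneq c r0; first by rewrite connect0.
    by move: c0; rewrite leqn0 => /eqP ->.
  move=> cm cx cdx; have [<-|/depP[p cp pc]] := eqVneq c r0; first by rewrite connect0.
  have px : dep p < dep x := leq_trans pc cdx.
  have npx : p != x by apply: contraTneq px => ->; rewrite ltnn.
  have [||r0x pr0] := IH p _ npx; first by rewrite -ltnS (leq_trans pc).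
    exact: ltnW.
  by split=> //; apply: connect_trans pr0; apply: connect1; rewrite /edge_in /= !inE cx npx.
have nzx : z != x by have := subsetP B'x _ zB'; rewrite !inE.
have [r0x zr0] := down _ _ (leqnn _) nzx zx.
have [p xp px] : exists2 p, edge x p & dep p < dep x by apply: depP; rewrite eq_sym.
have npx : p != x by apply: contraTneq px => ->; rewrite ltnn.
have [_ pr0] := down _ _ (leqnn _) npx (ltnW px).
have pa : p != a by apply: contraTneq px => ->; rewrite -leqNgt.
have xa' : edge x a by rewrite edge_sym.
move/negP: (tree_cut treeT xp xa' pa); apply.
apply: connect_trans pr0 _; apply: (@connect_trans _ _ z).
  by rewrite connect_edge_in_sym.
apply: (@connect_trans _ _ y).
  by rewrite connect_edge_in_sym; move: zC; rewrite inE => /andP[].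
by move: aC; rewrite inE => /andP[].
Qed.

(** Each round adds one member to the packing and one bag to the cover; the members missed by the
    bag are disjoint from the chosen one and are treated recursively. *)
Lemma erdos_posa n (H : {set G} -> Prop) :
  (forall B, H B -> connected_set B) ->
  (exists s, [/\ size s = n, disjoint_family s & forall B, B \in s -> H B]) \/
  (exists2 Z : {set G}, #|Z| <= n * w & forall B, H B -> ~~ [disjoint B & Z]).
Proof.
elim: n H => [|n IHn] H cH; first by left; exists [::].
have [[B0 HB0]|noH] := pselect (exists B, H B); last first.
  by right; exists set0; rewrite ?cards0 // => B HB; case: noH; exists B.
have [B [x [HB sepB]]] := deepest_member cH HB0.
have [B'|[s [ss ds Hs]]|[Z cZ hZ]] := IHn (fun B' => H B' /\ [disjoint B' & W x]).
- by move=> [/cH].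
- left; exists (B :: s); split; first by rewrite /= ss.
    rewrite /disjoint_family pairwise_cons; apply/andP; split => //.
    by apply/allP => B' /Hs[HB' dB']; apply: sepB.
  by move=> B'; rewrite inE => /orP[/eqP -> //|/Hs[]].
right; exists (W x :|: Z).
  by rewrite mulSn (leq_trans (leq_card_setU _ _)) // leq_add.
move=> B' HB'; have [dB'|] := boolP [disjoint B' & W x].
  by apply: contra (hZ _ (conj HB' dB')); apply: disjointWr; apply: subsetUr.
by apply: contra; apply: disjointWr; apply: subsetUl.
Qed.

End ErdosPosa.

(** * Weak reachability towards a subset *)

Section Walks.
Variable G : sgraph.
Implicit Types (K S Q C D : {set G}) (u v x y : G) (rho : G -> nat).

(* Only visits to [S] are counted: moving outside [S] is free. *)
Inductive walk Q S : nat -> G -> G -> Prop :=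
| walk_nil N u : u \in Q -> (u \in S) <= N -> walk Q S N u u
| walk_cons N u x v :
    u \in Q -> edge u x -> walk Q S N x v -> walk Q S ((u \in S) + N) u v.

Lemma walk_leq Q S N N' u v : walk Q S N u v -> N <= N' -> walk Q S N' u v.
Proof.
move=> wlk; elim: wlk N' => {N u v} [N u uQ uN|N u x v uQ ux _ IH] N' le.
  by apply: walk_nil => //; apply: leq_trans le.
rewrite -(subnKC (leq_trans (leq_addr _ _) le)); apply: walk_cons ux _ => //.
by apply: IH; rewrite leq_subRL // (leq_trans (leq_addr _ _) le).
Qed.

Lemma walk_start Q S N u v : walk Q S N u v -> u \in Q.
Proof. by case. Qed.

Lemma walk_end Q S N u v : walk Q S N u v -> v \in Q.
Proof. by elim. Qed.

Lemma walk_sub Q Q' S S' N u v : Q \subset Q' ->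
  {in Q, forall x, x \in S' -> x \in S} -> walk Q S N u v -> walk Q' S' N u v.
Proof.
move=> /subsetP QQ' SS'; have le x : x \in Q -> (x \in S') <= (x \in S).
  by move=> xQ; have := SS' x xQ; case: (x \in S') => // ->.
elim=> {N u v} [N u uQ uN|N u x v uQ ux _ IH].
  by apply: walk_nil; [apply: QQ'|apply: leq_trans (le _ uQ) uN].
apply: (@walk_leq _ _ ((u \in S') + N)); last by rewrite leq_add2r le.
by apply: walk_cons ux IH; apply: QQ'.
Qed.

Lemma walk_restrict Q S C N u v :
  (forall x y, x \in C -> x \in Q -> y \in Q -> edge x y -> y \in C) ->
  walk Q S N u v -> u \in C -> walk (Q :&: C) S N u v.
Proof.
move=> clos; elim=> {N u v} [N u uQ uN|N u x v uQ ux wlk IH] uC.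
  by apply: walk_nil => //; rewrite inE uQ.
apply: (walk_cons _ ux); first by rewrite inE uQ.
exact: IH (clos _ _ uC uQ (walk_start wlk) ux).
Qed.

Lemma walk_trans Q S N1 N2 u x v :
  walk Q S N1 u x -> walk Q S N2 x v -> walk Q S (N1 + N2) u v.
Proof.
elim=> {N1 u x} [N u uQ uN|N u y x uQ uy _ IH] wlk.
  by apply: walk_leq wlk (leq_addl _ _).
by rewrite -addnA; apply: walk_cons uy (IH wlk).
Qed.

Lemma walk_connected Q S C x y : connected_set C -> C \subset Q ->
  [disjoint C & S] -> x \in C -> y \in C -> walk Q S 0 x y.
Proof.
move=> cC /subsetP CQ /pred0P CS xC yC.
have nS z : z \in C -> (z \in S) = false by move=> zC; have := CS z; rewrite /= zC.
have /connectP[p pth ->] := connected_connect cC xC yC.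
elim: p x xC pth => [|z p IH] x xC /=.
  by move=> _; apply: walk_nil; [apply: CQ|rewrite nS].
move=> /andP[/and3P[_ zC xz] pth].
have -> : 0 = (x \in S) + 0 by rewrite nS.
by apply: walk_cons xz (IH _ zC pth); apply: CQ.
Qed.

Lemma path_walk Q S u p : path (@edge G) u p -> all (mem Q) (u :: p) ->
  walk Q S (size p).+1 u (last u p).
Proof.
elim: p u => [|x p IH] u /=.
  by move=> _ /andP[uQ _]; apply: walk_nil => //; case: (_ \in _).
move=> /andP[ux pth] /andP[uQ al].
apply: (@walk_leq _ _ ((u \in S) + (size p).+1)); last by case: (_ \in _).
by apply: walk_cons ux (IH _ pth al).
Qed.

Definition above K S rho m : {set G} := [set x in K | (x \in S) ==> (m <= rho x)].

Lemma aboveP K S rho m x :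
  reflect (x \in K /\ (x \in S -> m <= rho x)) (x \in above K S rho m).
Proof. by rewrite inE; apply: (iffP andP) => -[? /implyP]. Qed.

(** [rho] may have ties. They only enlarge the set: it contains what is reached in any linear order
    refining [rho]. *)
Definition wreach N K S rho u : {set G} :=
  [set v in S | `[< walk (above K S rho (rho v)) S N u v >]].

Lemma wreachP N K S rho u v :
  reflect (v \in S /\ walk (above K S rho (rho v)) S N u v)
          (v \in wreach N K S rho u).
Proof. by rewrite inE; apply: (iffP andP) => -[? /asboolP]. Qed.

Definition bounded N K S c : Prop :=
  exists rho, forall u, u \in K -> #|wreach N K S rho u| <= c.

Lemma bounded_card N K S c : #|S| <= c -> bounded N K S c.
Proof.
move=> cS; exists (fun=> 0) => u _; apply: leq_trans cS.
by apply: subset_leq_card; apply/subsetP => v /wreachP[].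
Qed.

Lemma bounded_leq N K S c c' : c <= c' -> bounded N K S c -> bounded N K S c'.
Proof. by move=> le [rho b]; exists rho => u /b bu; apply: leq_trans le. Qed.

Lemma bounded_restrict N K D S c : D \subset K ->
  bounded N K S c -> bounded N D (S :&: D) c.
Proof.
move=> /subsetP DK [rho b]; exists rho => u uD.
apply: leq_trans (b u (DK _ uD)); apply: subset_leq_card.
apply/subsetP => v /wreachP[/setIP[vS vD] wlk]; apply/wreachP; split=> //.
apply: walk_sub wlk => [|x /aboveP[xD _] xS]; last by rewrite inE xS.
apply/subsetP => x /aboveP[xD xm]; apply/aboveP; split; first exact: DK.
by move=> xS; apply: xm; rewrite inE xS.
Qed.

Lemma component_of_eq (A : {set G}) x y :
  y \in component_of A x -> component_of A y = component_of A x.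
Proof.
move=> yC; have yA := subsetP (component_of_sub _ _) _ yC.
have xA : x \in A.
  move: yC; rewrite inE => /andP[_ /connectP[[|z p]]]; first by move=> _ /= <-.
  by rewrite /= => /andP[/and3P[]].
by apply: (@components_eq _ A _ _ y); rewrite ?mem_components ?mem_component_of.
Qed.

(** All of [S0] is placed before the rest of [S1]. A walk to a later vertex avoids [S0] and stays in
    one component of [K :\: S0], so the orders of the components never interact. *)
Lemma bounded_components N K S0 S1 c0 c1 :
  bounded N K S0 c0 ->
  (forall C, C \in components (K :\: S0) -> bounded N C (S1 :&: C) c1) ->
  bounded N K (S0 :|: S1) (c0 + c1).
Proof.
move=> [rho0 b0] b1.
have /choice[rhoC bC] (C : {set G}) : exists rho, C \in components (K :\: S0) ->
    forall u, u \in C -> #|wreach N C (S1 :&: C) rho u| <= c1.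
  have [/b1[rho b]|] := boolP (C \in components (K :\: S0)); first by exists rho.
  by exists (fun=> 0).
pose m0 := (\max_x rho0 x).+1.
pose comp := component_of (K :\: S0).
pose rho x := if x \in S0 then rho0 x else m0 + rhoC (comp x) x.
exists rho => u uK.
pose R1 := if u \in S0 then set0 else wreach N (comp u) (S1 :&: comp u) (rhoC (comp u)) u.
have cR1 : #|R1| <= c1.
  rewrite /R1; have [_|uS0] := ifPn; first by rewrite cards0.
  have uD : u \in K :\: S0 by rewrite inE uS0.
  by apply: bC; [apply: mem_components|apply: mem_component_of].
apply: (@leq_trans #|wreach N K S0 rho0 u :|: R1|); last first.
  by apply: leq_trans (leq_card_setU _ _) _; apply: leq_add => //; apply: b0.
apply: subset_leq_card; apply/subsetP => v /wreachP[vS wlk]; rewrite inE.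
have [vS0|vS0] := boolP (v \in S0).
  apply/orP; left; apply/wreachP; split=> //.
  apply: walk_sub wlk => [|x _ xS0]; last by rewrite inE xS0.
  apply/subsetP => x /aboveP[xK xm]; apply/aboveP; split=> // xS0.
  by have := xm; rewrite inE xS0 /rho xS0 vS0; apply.
have vS1 : v \in S1 by move: vS; rewrite inE (negbTE vS0).
set Q := above _ _ _ _ in wlk.
have QD : Q \subset K :\: S0.
  apply/subsetP => x /aboveP[xK xm]; rewrite inE xK andbT; apply/negP => xS0.
  have := xm; rewrite inE xS0 /rho (negbTE vS0) xS0 => /(_ isT).
  apply/negP; rewrite -ltnNge; apply: leq_trans (leq_addr _ _).
  by rewrite ltnS; apply: leq_bigmax.
have uD := subsetP QD _ (walk_start wlk).
apply/orP; right; rewrite /R1; have /setDP[_ /negbTE ->] := uD.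
have clos x y : x \in comp u -> x \in Q -> y \in Q -> edge x y -> y \in comp u.
  by move=> xC _ yQ; apply: component_of_edge => //; apply: (subsetP QD).
have {wlk}wlk := walk_restrict clos wlk (mem_component_of uD).
have /setIP[_ vC] := walk_end wlk.
apply/wreachP; split; first by rewrite inE vS1.
apply: walk_sub wlk => [|x _ /setIP[xS1 _]]; last by rewrite inE xS1 orbT.
apply/subsetP => x /setIP[xQ xC]; apply/aboveP; split=> // /setIP[xS1 _].
have /aboveP[xK xm] := xQ; have /setDP[_ xS0] := subsetP QD _ xQ.
have := xm; rewrite inE xS1 orbT /rho (negbTE vS0) (negbTE xS0) => /(_ isT).
by rewrite leq_add2l /comp (component_of_eq vC) (component_of_eq xC).
Qed.

Lemma trivIset_components (A : {set G}) : trivIset (components A).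
Proof.
apply/trivIsetP => C D CA DA /eqP CD; apply/pred0P => x /=; apply/negP.
by move=> /andP[xC xD]; apply: CD; apply: components_eq CA DA xC xD.
Qed.

Lemma glue_sets (P : {set {set G}}) (Phi : {set G} -> {set G} -> Prop) :
  trivIset P ->
  (forall D, D \in P -> exists2 S : {set G}, S \subset D & Phi D S) ->
  exists2 S : {set G}, S \subset cover P & forall D, D \in P -> Phi D (S :&: D).
Proof.
move=> /trivIsetP trivP ex.
have /choice[f fP] (D : {set G}) : exists S, D \in P -> S \subset D /\ Phi D S.
  by have [/ex[S SD PhiS]|] := boolP (D \in P); [exists S|exists set0].
exists (\bigcup_(D in P) f D) => [|D DP].
  apply/bigcupsP => D DP; apply: subset_trans (fP D DP).1 _.
  exact: bigcup_sup.
suff -> : (\bigcup_(D in P) f D) :&: D = f D by have [] := fP D DP.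
apply/setP => x; rewrite inE; apply/andP/idP => [[/bigcupP[E EP xE] xD]|xf].
  have [<- //|ED] := eqVneq E D; have /pred0P/(_ x) := trivP _ _ EP DP ED.
  by rewrite /= xD (subsetP (fP E EP).1 _ xE).
by split; [apply/bigcupP; exists D|apply: (subsetP (fP D DP).1)].
Qed.

Definition hits (F : {set G} -> Prop) K S : Prop :=
  forall B, connected_set B -> B \subset K -> F B -> ~~ [disjoint B & S].

Definition solvable N (F : {set G} -> Prop) K c : Prop :=
  exists2 S : {set G}, S \subset K & hits F K S /\ bounded N K S c.

Lemma solvable_leq N F K c c' : c <= c' -> solvable N F K c -> solvable N F K c'.
Proof. by move=> le [S SK [hS bS]]; exists S => //; split=> //; apply: bounded_leq bS. Qed.

Lemma solvable_void N (F : {set G} -> Prop) K c :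
  (forall B, connected_set B -> B \subset K -> ~ F B) -> solvable N F K c.
Proof.
move=> noF; exists set0; rewrite ?sub0set //; split; last first.
  by apply: bounded_card; rewrite cards0.
by move=> B cB BK FB; case: (noF B cB BK FB).
Qed.

Lemma solvable_sub N F K D c : D \subset K -> solvable N F K c -> solvable N F D c.
Proof.
move=> DK [S SK [hS bS]]; exists (S :&: D); first exact: subsetIr.
split; last exact: bounded_restrict bS.
move=> B cB BD FB; have := hS B cB (subset_trans BD DK) FB.
move=> /pred0Pn[x /andP[/= xB xS]]; apply/pred0Pn; exists x.
by rewrite /= xB inE xS (subsetP BD).
Qed.

Lemma solvable_components N F K S0 c0 c1 : S0 \subset K ->
  bounded N K S0 c0 ->
  (forall C, C \in components (K :\: S0) -> solvable N F C c1) ->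
  solvable N F K (c0 + c1).
Proof.
move=> S0K b0 sol.
have [S1 S1K S1P] := glue_sets (trivIset_components _) sol.
have cov : cover (components (K :\: S0)) \subset K :\: S0.
  by apply/bigcupsP => C; apply: components_sub.
exists (S0 :|: S1).
  rewrite subUset S0K (subset_trans S1K) // (subset_trans cov) //.
  exact: subsetDl.
split; last by apply: bounded_components b0 _ => C /S1P[].
move=> B cB BK FB; have [dB|] := boolP [disjoint B & S0]; last first.
  by apply: contra; apply: disjointWr; apply: subsetUl.
have BD : B \subset K :\: S0 by rewrite subsetD BK.
have [C CK BC] := connected_in_component cB BD.
have [hC _] := S1P C CK; apply: contra (hC B cB BC FB); apply: disjointWr.
by rewrite subIset // subsetUr.
Qed.

End Walks.

(** * Rich models *)

(** The Erdos-Posa property with a cover linear in [w]. The application takes the largest bag size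
    for [w], which is how treewidth enters the bound. *)
Definition packing_covering (G : sgraph) w : Prop :=
  forall n (H : {set G} -> Prop), (forall B, H B -> connected_set B) ->
  (exists s, [/\ size s = n, disjoint_family s & forall B, B \in s -> H B]) \/
  (exists2 Z : {set G}, #|Z| <= n * w & forall B, H B -> ~~ [disjoint B & Z]).

Section Rich.
Variables (G : sgraph) (d : nat).
Implicit Types (F : {set G} -> Prop) (A B C D K M R S : {set G}).

Definition upclosed F : Prop := forall A B, A \subset B -> F A -> F B.

Definition near R F A : Prop := F A /\ touch R A.

Lemma upclosed_near R F : upclosed F -> upclosed (near R F).
Proof. by move=> uF A B AB [/(uF _ _ AB) FB tA]; split=> //; apply: touch_sub tA. Qed.

(* [rich h F K]: the set [K] contains a model, with all branch sets satisfying
   [F], of the closure of the complete [d]-ary tree with [h] levels. The root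
   [R] is adjacent to every other branch set, which is why the requirement
   [near R] is passed on to the [d] subtrees. *)
Fixpoint rich h F K : Prop :=
  if h is h'.+1 then exists R, [/\ R \subset K, connected_set R, F R &
    exists s, [/\ size s = d, disjoint_family s &
      forall B, B \in s -> B \subset K :\: R /\ rich h' (near R F) B]]
  else True.

Definition rich_copies n h F K : Prop :=
  exists s, [/\ size s = n, disjoint_family s &
    forall B, B \in s -> B \subset K /\ rich h F B].

Lemma rich_sub h F F' K K' : K \subset K' -> (forall A, F A -> F' A) ->
  rich h F K -> rich h F' K'.
Proof.
elim: h F F' K K' => //= h IH F F' K K' KK' FF' [R [RK cR FR [s [ss ds sP]]]].
exists R; split; [exact: subset_trans KK'|by []|exact: FF'|].
exists s; split=> // B /sP[BK rB]; split.
  by apply: subset_trans BK _; apply: setSD.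
by apply: IH rB => // A [/FF' FA tA].
Qed.

Lemma rich1 F K : connected_set K -> F K -> rich 1 F K.
Proof.
(* The subtrees have height zero, and [rich 0] holds of the empty set. *)
move=> cK FK; exists K; split=> //; exists (nseq d set0); rewrite size_nseq; split=> //.
  elim: d => //= k IH; rewrite /disjoint_family /= [X in _ && X]IH andbT all_nseq.
  by apply/orP; right; apply/pred0P => x; rewrite /= inE.
by move=> _ /nseqP[-> _]; rewrite sub0set.
Qed.

(** One of the [d.+1] copies is sacrificed: [R] may fail [F], but its union with the root of that
    copy satisfies it. The other [d] copies touch [R] and become the subtrees. *)
Lemma no_near_copies h F R K M : upclosed F -> connected_set R ->
  R \subset M -> K \subset M -> [disjoint R & K] -> ~ rich h.+2 F M ->
  ~ rich_copies d.+1 h.+1 (near R F) K.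
Proof.
move=> uF cR RM KM dRK nrich [[|B0 s] [//= [ss] /andP[/allP dB0 ds] sP]].
have [B0K [R0 [R0B0 cR0 [FR0 tR0] _]]] := sP B0 (mem_head _ _).
apply: nrich; exists (R :|: R0); split.
- by rewrite subUset RM (subset_trans R0B0) ?(subset_trans B0K).
- exact: connected_setU.
- exact: uF (subsetUr _ _) FR0.
exists s; split=> // B Bs; have [BK rB] := sP B (mem_behead (s := B0 :: s) Bs).
split; last first.
  apply: (@rich_sub h.+1 _ _ _ _ _ _ rB) => // A [FA tA]; split=> //.
  by apply: touch_sub tA => //; apply: subsetUl.
rewrite subsetD (subset_trans BK KM) disjoint_sym /=; apply/pred0P => x /=.
apply/negP => /andP[/setUP[xR|xR0] xB].
  by have /pred0P/(_ x) := dRK; rewrite /= xR (subsetP BK _ xB).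
by have /pred0P/(_ x) := dB0 B Bs; rewrite /= xB (subsetP R0B0).
Qed.

Section Cover.
Variables (w N : nat).
Hypothesis pc : packing_covering G w.

Lemma solvable_no_copies h n c F K :
  (forall C, connected_set C -> ~ rich h F C -> solvable N F C c) ->
  ~ rich_copies n h F K -> solvable N F K (n * w + c).
Proof.
move=> sol ncop.
have [B [] //|[s [ss ds sP]]|[Z cZ hZ]] := pc n
    (H := fun B => [/\ connected_set B, B \subset K & rich h F B]).
  by case: ncop; exists s; split=> // B /sP[].
apply: (@solvable_components _ _ _ _ (Z :&: K)); first exact: subsetIr.
  by apply: bounded_card; apply: leq_trans cZ; rewrite subset_leq_card ?subsetIl.
move=> C CK; have cC := components_connected CK; apply: sol => // rC.
have sC := components_sub CK.
have /pred0Pn[x /andP[/= xC xZ]] :=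
  hZ C (And3 cC (subset_trans sC (subsetDl _ _)) rC).
by have := subsetP sC _ xC; rewrite !inE xZ /= => /andP[/negPf ->].
Qed.

End Cover.

End Rich.

(** * Levels *)

Lemma card_leq_classes (T : finType) (A : {set T}) (key : T -> nat) m c :
  (forall x, x \in A -> key x < m) ->
  (forall k, #|[set x in A | key x == k]| <= c) -> #|A| <= m * c.
Proof.
elim: m A => [|m IH] A keyA classA.
  by rewrite leqn0 cards_eq0; apply/eqP/setP => x; rewrite inE; apply/negP => /keyA.
have -> : A = [set x in A | key x == m] :|: [set x in A | key x < m].
  apply/setP => x; rewrite !inE -andb_orr -leq_eqVlt.
  by case: (boolP (x \in A)) => // /keyA; rewrite ltnS => ->.
apply: leq_trans (leq_card_setU _ _) _; rewrite mulSn leq_add //.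
apply: IH => [x|k]; first by rewrite inE => /andP[].
apply: leq_trans (classA k); apply: subset_leq_card; apply/subsetP => x.
by rewrite !inE => /andP[/andP[-> _] ->].
Qed.

Section Levels.
Variable G : sgraph.
Implicit Types (F : {set G} -> Prop) (B C D K M R S Q : {set G}) (lev : G -> nat).

(** The level is the nesting depth as seen from [R]. With level zero forced next to [R], a leveling
    of a nested part can be shifted by one and glued on: edges entering that part rise exactly from
    0 to 1. *)
Definition leveling K R S lev : Prop :=
  (forall x y, x \in K -> y \in K -> edge x y -> lev x < lev y ->
     lev y = (lev x).+1 /\ x \in S) /\
  (forall x, x \in K -> touch R [set x] -> lev x = 0).

Section Leveling.
Variables (K R S : {set G}) (lev : G -> nat).
Hypothesis levP : leveling K R S lev.

Lemma walk_lev_descent Q N u v : Q \subset K -> walk Q S N u v -> lev u <= lev v + N.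
Proof.
(* A descent is paid for by its lower end, which comes next on the walk; so the induction also
   carries the visit of the starting vertex. *)
move=> /subsetP QK wlk; apply: (@leq_trans (lev u + (u \in S))).
  exact: leq_addr.
elim: wlk => {N u v} [N u _ uN|N u x v uQ ux wlk IH]; first by rewrite leq_add2l.
rewrite addnCA addnC leq_add2l; apply: leq_trans IH.
have [le|lt] := leqP (lev u) (lev x); first exact: leq_trans le (leq_addr _ _).
have xu : edge x u by rewrite edge_sym.
have [-> ->] := levP.1 _ _ (QK _ (walk_start wlk)) (QK _ uQ) xu lt.
by rewrite addn1.
Qed.

Lemma walk_lev_ascent Q N u v : Q \subset K -> walk Q S N u v -> lev v <= lev u + N.
Proof.
move=> /subsetP QK; elim=> {N u v} [N u _ _|N u x v uQ ux wlk IH]; first exact: leq_addr.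
apply: leq_trans IH _; rewrite addnA leq_add2r.
have [le|lt] := leqP (lev x) (lev u); first exact: leq_trans le (leq_addr _ _).
have [-> ->] := levP.1 _ _ (QK _ uQ) (QK _ (walk_start wlk)) ux lt.
by rewrite addn1.
Qed.

(** Levels change by at most one per edge, so some edge of the walk joins levels [k] and [k.+1]; its
    lower end is the vertex sought. *)
Lemma walk_lev_cross Q N u v k : Q \subset K -> walk Q S N u v ->
  (lev v <= k < lev u) || (lev u <= k < lev v) ->
  exists z, [/\ z \in Q, z \in S & lev z = k].
Proof.
move=> /subsetP QK; elim=> {N u v} [N u _ _|N u x v uQ ux wlk IH].
  by rewrite orbb => /andP[le /(leq_ltn_trans le)]; rewrite ltnn.
have xQ := walk_start wlk; have xu : edge x u by rewrite edge_sym.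
move=> kP; have [kx|] := boolP ((lev v <= k < lev x) || (lev x <= k < lev v)).
  exact: IH.
move=> nkx; have [lt|lt|eq] := ltngtP (lev u) (lev x); last lia.
  have [ex uS] := levP.1 _ _ (QK _ uQ) (QK _ xQ) ux lt.
  by exists u; split=> //; lia.
have [eu xS] := levP.1 _ _ (QK _ xQ) (QK _ uQ) xu lt.
by exists x; split=> //; lia.
Qed.

End Leveling.
End Levels.

(** * Removing the part of [S] enclosed in disjoint sets *)

Section Reroute.
Variable G : sgraph.
Implicit Types (C D K S : {set G}) (P : {set {set G}}).

(* A passage through [D] can be replaced by one through its core, which is
   connected and avoids [S], at no cost. *)
Lemma bounded_reroute N K S P (core : {set G} -> {set G}) c :
  trivIset P ->
  (forall D, D \in P -> [/\ D \subset K, core D \subset D,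
     connected_set (core D), [disjoint core D & S] &
     forall x y, x \in D -> y \in K -> y \notin D -> edge x y ->
       x \in core D /\ y \notin cover P]) ->
  bounded N K S c -> bounded N K (S :\: cover P) c.
Proof.
move=> trivP coreP [rho b]; exists rho => u uK.
have /choice[pt ptP] D : exists z, D \in P -> z \in core D.
  have [DP|] := boolP (D \in P); last by exists u.
  by have [_ _ /connected_nonempty[z zC] _ _] := coreP D DP; exists z.
(* All of [D] collapses to one vertex of its core. Steps inside [D] become trivial, and an edge
   between [D] and its complement has its end in the core. *)
pose rep x := if x \in cover P then pt (pblock P x) else x.
have repN x : x \notin cover P -> rep x = x by rewrite /rep => /negbTE ->.
have repD D x : D \in P -> x \in D -> rep x = pt D.
  move=> DP xD; rewrite /rep (def_pblock trivP DP xD).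
  by rewrite (_ : x \in cover P) //; apply/bigcupP; exists D.
have repK x : x \in K -> rep x \in K.
  move=> xK; have [/bigcupP[D DP xD]|/repN -> //] := boolP (x \in cover P).
  have [DK CD _ _ _] := coreP D DP; rewrite (repD D) //.
  exact: (subsetP DK) (subsetP CD _ (ptP D DP)).
have coreS D x : D \in P -> x \in core D -> (x \in S) = false.
  by move=> DP xC; have [_ _ _ /pred0P/(_ x)] := coreP D DP; rewrite /= xC.
have inSD x : x \notin cover P -> (x \in S :\: cover P) = (x \in S).
  by move=> xP; rewrite inE xP.
have reroute m k x y :
    walk (above K (S :\: cover P) rho m) (S :\: cover P) k x y ->
    walk (above K S rho m) S k (rep x) (rep y).
  set Q' := above K (S :\: _) rho m; set Q := above K S rho m.
  have Q'K z : z \in Q' -> z \in K by case/aboveP.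
  have Q'Q z : z \in Q' -> z \notin cover P -> z \in Q.
    by move=> /aboveP[zK zm] zP; apply/aboveP; split=> // zS; apply: zm; rewrite inE zP.
  have coreQ D : D \in P -> core D \subset Q.
    move=> DP; have [DK CD _ _ _] := coreP D DP; apply/subsetP => z zC.
    apply/aboveP; split; first exact: (subsetP DK) (subsetP CD _ zC).
    by rewrite (coreS D).
  have free D z z' : D \in P -> z \in core D -> z' \in core D -> walk Q S 0 z z'.
    by move=> DP; have [_ _ cC dC _] := coreP D DP; apply: walk_connected; rewrite ?coreQ.
  elim=> {k x y} [k x xQ xk|k x z y xQ xz wlk IH].
    have [/bigcupP[D DP xD]|xP] := boolP (x \in cover P).
      rewrite (repD D x DP xD); apply: (@walk_leq _ _ _ 0) => //.
      by apply: (free D) => //; apply: ptP.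
    by rewrite repN //; apply: walk_nil; [apply: Q'Q|rewrite -inSD].
  have zQ := walk_start wlk; have zx : edge z x by rewrite edge_sym.
  have [/bigcupP[D DP xD]|xP] := boolP (x \in cover P); last first.
    rewrite repN // inSD //; apply: walk_cons (Q'Q _ xQ xP) xz _.
    have [/bigcupP[D DP zD]|zP] := boolP (z \in cover P); last by rewrite -(repN z).
    have xD : x \notin D by apply: contra xP => xD; apply/bigcupP; exists D.
    have [_ _ _ _ /(_ z x zD (Q'K _ xQ) xD zx)[zC _]] := coreP D DP.
    rewrite -[k]add0n; apply: walk_trans (free D z (rep z) DP zC _) IH.
    by rewrite (repD D) //; apply: ptP.
  apply: (@walk_leq _ _ _ k); last exact: leq_addl.
  have [zD|zD] := boolP (z \in D); first by rewrite (repD D x) // -(repD D z).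
  have [_ _ _ _ /(_ x z xD (Q'K _ zQ) zD xz)[xC zP]] := coreP D DP.
  rewrite -[k]add0n; apply: walk_trans (free D (rep x) x DP _ xC) _.
    by rewrite (repD D) //; apply: ptP.
  have -> : k = (x \in S) + k by rewrite (coreS D).
  apply: walk_cons xz _; first exact: (subsetP (coreQ D DP)).
  by rewrite -(repN z).
apply: leq_trans (b (rep u) (repK _ uK)); apply: subset_leq_card.
apply/subsetP => v /wreachP[/setDP[vS vP] /reroute wlk].
by apply/wreachP; split=> //; rewrite -{2}(repN v vP).
Qed.

End Reroute.

(** * One more level of the excluded tree for a factor linear in [r] *)

Section Fill.
Variable G : sgraph.
Variables (M K S : {set G}) (r0 : G) (active : {set G} -> Prop).
Hypotheses (cM : connected_set M) (KM : K \subset M) (cR : connected_set (M :\: K))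
  (r0R : r0 \in M :\: K).
Hypothesis activeP : forall C, active C ->
  C \in components (K :\: S) /\ ~~ touch (M :\: K) C.
Implicit Types C D : {set G}.

Definition outside C : {set G} := component_of (M :\: C) r0.

(* [C] together with everything that [C] separates from [M :\: K]. *)
Definition fill C : {set G} := M :\: outside C.

(** Maximality makes the children pairwise disjoint, while every active component still lies in one
    of them. *)
Definition children : {set {set G}} :=
  [set D | maxset [pred D : {set G} | `[< exists2 C, active C & D = fill C >]] D].

Let active_sub C : active C -> C \subset K.
Proof.
by move=> /activeP[/components_sub sC _]; apply: subset_trans sC (subsetDl _ _).
Qed.

Let R_out C : active C -> M :\: K \subset outside C.
Proof.
move=> aC; have RC : M :\: K \subset M :\: C by apply: setDS; apply: active_sub.
apply: connected_sub_component => //; exists r0 => //.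
by apply: mem_component_of; apply: (subsetP RC).
Qed.

Let r0_out C : active C -> r0 \in M :\: C.
Proof. by move=> /R_out sR; apply: (subsetP (component_of_sub _ _)) (subsetP sR _ r0R). Qed.

Lemma fill_sub C : active C -> fill C \subset K.
Proof.
move=> aC; apply/subsetP => x /setDP[xM xO]; apply: contraR xO => xK.
by apply: (subsetP (R_out aC)); rewrite inE xK.
Qed.

Lemma sub_fill C : active C -> C \subset fill C.
Proof.
move=> aC; apply/subsetP => x xC; rewrite inE (subsetP KM) ?(subsetP (active_sub aC)) //.
by rewrite andbT; apply: contraL xC => /(subsetP (component_of_sub _ _)) /setDP[].
Qed.

Lemma setD_fill C : M :\: fill C = outside C.
Proof.
rewrite setDDr setDv set0U; apply/setIidPr.
exact: subset_trans (component_of_sub _ _) (subsetDl _ _).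
Qed.

Lemma fill_connected C : active C -> connected_set (fill C).
Proof.
move=> aC; have [/components_connected cC _] := activeP aC.
by apply: connected_setD_component => //; apply: subset_trans (active_sub aC) KM.
Qed.

Lemma outside_connected C : active C -> connected_set (outside C).
Proof. by move=> aC; apply: component_of_connected; apply: r0_out. Qed.

(** The outer end [y] lies in [outside C], a component of [M :\: C], so [x] must be in [C]. As [C]
    does not touch [M :\: K], [y] is in [K]; as [C] is a component of [K :\: S], [y] is in [S]. *)
Lemma fill_edge C x y : active C ->
  x \in fill C -> y \in M -> y \notin fill C -> edge x y -> [/\ x \in C, y \in S & y \in K].
Proof.
move=> aC /setDP[xM xO] yM yF xy.
have yO : y \in outside C by rewrite -setD_fill inE yF.
have [CS ntC] := activeP aC.
have yx : edge y x by rewrite edge_sym.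
have xC : x \in C.
  by apply: contraR xO => xC; apply: component_of_edge yO _ yx; rewrite inE xC.
have yK : y \in K.
  apply: contraR ntC => yK; apply/touchP; exists y, x; split=> //.
  by rewrite inE yK.
split=> //; have /setDP[_ yC] := subsetP (component_of_sub _ _) _ yO.
apply: contraR yC => yS; apply: components_edge CS xC _ xy.
by rewrite inE yS.
Qed.

Lemma childP D : D \in children -> exists2 C, active C & D = fill C.
Proof. by rewrite inE => /maxsetP[/asboolP]. Qed.

Lemma child_max C : active C -> exists2 D, D \in children & fill C \subset D.
Proof.
move=> aC.
have [|D maxD sD] := @maxset_exists _
    [pred D : {set G} | `[< exists2 C, active C & D = fill C >]] (fill C).
  by apply/asboolP; exists C.
by exists D => //; rewrite inE.
Qed.

(** Otherwise the connected set [C2] misses [outside C1] altogether. Then [outside C1] is contained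
    in [outside C2], so [fill C2] lies in [fill C1], against maximality. *)
Let child_separate C1 C2 : active C1 -> active C2 ->
  fill C1 \in children -> fill C2 \in children -> fill C1 != fill C2 ->
  C2 \subset outside C1.
Proof.
move=> a1 a2; rewrite inE => _; rewrite inE => /maxsetP[_ max2] ne.
have [c2 _] := activeP a2; have [c1 _] := activeP a1.
have C21 : C2 \subset M :\: C1.
  rewrite subsetD (subset_trans (active_sub a2) KM) /=.
  have/trivIsetP := trivIset_components (K :\: S); apply => //.
  by apply: contraNneq ne => ->.
apply: contraR ne => nsub; rewrite (max2 (fill C1)) ?eqxx //.
  by apply/asboolP; exists C1.
have out12 : outside C1 \subset M :\: C2.
  have sub1 : outside C1 \subset M by apply: subset_trans (component_of_sub _ _) (subsetDl _ _).
  rewrite subsetD sub1 /=; apply/pred0P => x /=; apply/negP => /andP[x1 x2].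
  move/negP: nsub; apply; apply: connected_sub_component => //.
    exact: components_connected c2.
  by exists x.
apply: setDS; apply: connected_sub_component out12 _; first exact: outside_connected.
exists r0; first by rewrite mem_component_of ?r0_out.
by rewrite mem_component_of ?r0_out.
Qed.

(** By [child_separate] the connected set [fill C1] avoids [C2], and its part [C1] lies in
    [outside C2]; so all of it does. *)
Lemma child_disjoint D1 D2 : D1 \in children -> D2 \in children -> D1 != D2 ->
  [disjoint D1 & D2].
Proof.
move=> d1 d2; have [C1 a1 e1] := childP d1; have [C2 a2 e2] := childP d2; subst D1 D2.
move=> ne; have s21 := child_separate a1 a2 d1 d2 ne.
have s12 : C1 \subset outside C2 by apply: child_separate => //; rewrite eq_sym.
have cF := fill_connected a1.
suff: fill C1 \subset outside C2.
  by move=> sub; rewrite disjoint_sym disjoints_subset; apply/subsetP => x /setDP[_ xO];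
    rewrite inE; apply: contra xO => /(subsetP sub).
have [x xC1] := connected_nonempty (components_connected (activeP a1).1).
apply: connected_sub_component => //; last first.
  by exists x; [apply: (subsetP (sub_fill a1))|apply: (subsetP s12)].
rewrite subsetD subsetDl /=; apply/pred0P => y /=; apply/negP => /andP[/setDP[_ yO] y2].
by move/negP: yO; apply; apply: (subsetP s21).
Qed.

Lemma trivIset_children : trivIset children.
Proof. by apply/trivIsetP => D1 D2; apply: child_disjoint. Qed.

Lemma child_edge D x y : D \in children -> x \in D -> y \in M -> y \notin D ->
  edge x y -> [/\ y \in S, y \in K & y \notin cover children].
Proof.
move=> d1 xD yM yD xy; have [C1 a1 e1] := childP d1.
have [xC1 yS yK] : [/\ x \in C1, y \in S & y \in K].
  by apply: (fill_edge a1) xy; rewrite // -e1.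
split=> //; apply/negP => /bigcupP[D2 d2 yD2].
have [C2 a2 e2] := childP d2.
have ne : D != D2 by apply: contraNneq yD => ->.
have xD2 : x \notin D2.
  by apply/negP => xD2; have /pred0P/(_ x) := child_disjoint d1 d2 ne; rewrite /= xD xD2.
have yx : edge y x by rewrite edge_sym.
have xM : x \in M by apply: (subsetP KM); apply: (subsetP (fill_sub a1)); rewrite -e1.
(* Read backwards, the edge leaves [D2], so [y] lies in the component [C2] of [K :\: S], contrary to
   [y \in S]. *)
have [yC2 _ _] : [/\ y \in C2, x \in S & x \in K].
  by apply: (fill_edge a2) yx; rewrite // -e2.
by have [/components_sub/subsetP/(_ _ yC2)] := activeP a2; rewrite inE yS.
Qed.

End Fill.

(** * Nested levels of separators *)

Section TreeStep.
Variables (G : sgraph) (d h N c : nat) (F : {set G} -> Prop) (M : {set G}).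
Hypotheses (uF : upclosed F) (cM : connected_set M) (nrich : ~ rich d h.+2 F M).
Hypothesis solve : forall (F' : {set G} -> Prop) (K : {set G}), upclosed F' ->
  ~ rich_copies d d.+1 h.+1 F' K -> solvable N F' K c.
Implicit Types (B C D K S : {set G}).

(** Induction on the size of [K]. A set [S] from [solve] meets all members of [F] touching
    [M :\: K]; those it misses lie in children, which are treated recursively with their own
    complements as roots. The rest of [S] is level zero and comes first in the order. *)
Let tree_levels K : K \subset M -> connected_set K -> connected_set (M :\: K) ->
  exists S rho lev, [/\ S \subset K, hits F K S, leveling K (M :\: K) S lev &
    forall u, u \in K ->
      (forall v, v \in wreach N K S rho u -> lev v <= lev u) /\
      (forall i, #|[set v in wreach N K S rho u | lev v == i]| <= c)].
Proof.
have [n leK] := ubnP #|K|; elim: n K leK => // n IH K leK KM cK cR.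
have [r0 r0R] := connected_nonempty cR; set R := M :\: K in cR r0R *.
have dRK : [disjoint R & K].
  by rewrite disjoints_subset; apply/subsetP => x; rewrite !inE => /andP[].
have tRK : touch R K.
  apply: connected_touch_setD => //; first by case/andP: cK.
  by apply: contraTneq r0R => e; rewrite inE e andNb.
have ncop := no_near_copies uF cR (subsetDl M K) KM dRK nrich.
have [S SK [hS bS]] := solve (upclosed_near (R := R) uF) ncop.
pose active C := C \in components (K :\: S) /\ F C.
have activeP C : active C -> C \in components (K :\: S) /\ ~~ touch R C.
  move=> [CS FC]; split=> //; apply/negP => tC.
  have CKS := components_sub CS.
  have /negP := hS C (components_connected CS) (subset_trans CKS (subsetDl _ _)) (conj FC tC).
  by apply; move: CKS; rewrite subsetD => /andP[].
pose P := children M r0 active.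
have trivP : trivIset P by apply: trivIset_children activeP.
have edgeP := child_edge cM KM cR r0R activeP.
have subP D : D \in P -> D \subset K.
  by move=> /childP[C aC ->]; apply: fill_sub activeP _ aC.
have coverK : cover P \subset K by apply/bigcupsP.
have /choice[core coreP] D : exists C, D \in P -> active C /\ D = fill M r0 C.
  by have [/childP[C aC e]|] := boolP (D \in P); [exists C|exists set0].
(* [S] is dropped inside the children; the core of a child is the active component that it fills. *)
have [rho0 b0] : bounded N K (S :\: cover P) c.
  apply: bounded_reroute bS => // D DP; have [aC eD] := coreP D DP.
  have [CS _] := activeP _ aC; split.
  - exact: subP.
  - by rewrite {2}eD; apply: sub_fill activeP _ aC.
  - exact: components_connected CS.
  - by have := components_sub CS; rewrite subsetD => /andP[].
  move=> x y xD yK yD xy; have yM := subsetP KM _ yK.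
  have [_ _ ->] := edgeP _ _ _ DP xD yM yD xy; split=> //.
  have xF : x \in fill M r0 (core D) by rewrite -eD.
  have yF : y \notin fill M r0 (core D) by rewrite -eD.
  by have [] := fill_edge activeP aC xF yM yF xy.
have ltP D : D \in P -> #|D| < n.
  move=> DP; apply: leq_trans (_ : #|K| <= n); last by rewrite -ltnS.
  apply: proper_card; rewrite properE subP //=; apply/negP => KD.
  have /touchP[x [y [xR yK xy]]] := tRK.
  have yD := subsetP KD _ yK; have yx : edge y x by rewrite edge_sym.
  have /setDP[xM xK] := xR.
  have xD : x \notin D by apply: contra xK; apply: (subsetP (subP D DP)).
  by have [_ xK' _] := edgeP _ _ _ DP yD xM xD yx; rewrite xK' in xK.
have cP D : D \in P -> connected_set D /\ connected_set (M :\: D).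
  move=> /childP[C aC ->]; split; first exact: fill_connected activeP _ aC.
  by rewrite setD_fill; apply: outside_connected activeP _ aC.
have /choice[sol solP] D : exists p : {set G} * (G -> nat) * (G -> nat), D \in P ->
    let: (SD, rho, lev) := p in
    [/\ SD \subset D, hits F D SD, leveling D (M :\: D) SD lev &
    forall u, u \in D ->
      (forall v, v \in wreach N D SD rho u -> lev v <= lev u) /\
      (forall i, #|[set v in wreach N D SD rho u | lev v == i]| <= c)].
  have [DP|] := boolP (D \in P); last by exists (set0, fun=> 0, fun=> 0).
  have [cD cOD] := cP D DP.
  have [|||SD [rho [lev lP]]] := IH D (ltP D DP) => //.
    exact: subset_trans (subP D DP) KM.
  by exists (SD, rho, lev).
pose SD D := (sol D).1.1; pose rhoD D := (sol D).1.2; pose levD D := (sol D).2.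
have {}solP D : D \in P ->
    [/\ SD D \subset D, hits F D (SD D), leveling D (M :\: D) (SD D) (levD D) &
    forall u, u \in D ->
      (forall v, v \in wreach N D (SD D) (rhoD D) u -> levD D v <= levD D u) /\
      (forall i, #|[set v in wreach N D (SD D) (rhoD D) u | levD D v == i]| <= c)].
  by move=> /solP; rewrite /SD /rhoD /levD; case: (sol D) => [[]].
pose blk := pblock P.
have blkE D x : D \in P -> x \in D -> blk x = D by apply: def_pblock.
have covE D x : D \in P -> x \in D -> x \in cover P by move=> ? ?; apply/bigcupP; exists D.
(* Children come after level zero: a walk to a vertex of a child cannot visit [S] outside the
   children, which is the only way into or out of a child. *)
pose m0 := (\max_x rho0 x).+1.
pose T := [set x in K | if x \in cover P then x \in SD (blk x) else x \in S].
pose rho x := if x \in cover P then m0 + rhoD (blk x) x else rho0 x.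
pose lev x := if x \in cover P then (levD (blk x) x).+1 else 0.
have TD D x : D \in P -> x \in D -> (x \in T) = (x \in SD D).
  by move=> DP xD; rewrite inE (covE D) // (blkE D) // (subsetP (subP D DP)).
have TN x : x \notin cover P -> (x \in T) = (x \in S).
  move=> xP; rewrite inE (negbTE xP); apply/andP/idP => [[] //|xS].
  by rewrite (subsetP SK).
have rhoE D x : D \in P -> x \in D -> rho x = m0 + rhoD D x.
  by move=> DP xD; rewrite /rho (covE D) // (blkE D).
have rhoN x : x \notin cover P -> rho x < m0.
  by move=> xP; rewrite /rho (negbTE xP) ltnS; apply: leq_bigmax.
have levE D x : D \in P -> x \in D -> lev x = (levD D x).+1.
  by move=> DP xD; rewrite /lev (covE D) // (blkE D).
have levN x : x \notin cover P -> lev x = 0 by rewrite /lev => /negbTE ->.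
exists T, rho, lev; split.
- by apply/subsetP => x; rewrite inE => /andP[].
- move=> B cB BK FB.
  have [[D DP BD]|nBD] := pselect (exists2 D, D \in P & B \subset D).
    have [_ hD _ _] := solP D DP.
    have /pred0Pn[x /andP[/= xB xS]] := hD B cB BD FB.
    by apply/pred0Pn; exists x; rewrite /= xB (TD D) // (subsetP BD).
  have [dB|/pred0Pn[x /andP[/= xB /bigcupP[D DP xD]]]] := boolP [disjoint B & cover P]; last first.
    have [||a [b [aB aD bB bD ab]]] := connected_cross (C := D) cB.
    - by exists x.
    - by apply/negP => BD; apply: nBD; exists D.
    have [bT bK bP] := edgeP _ _ _ DP aD (subsetP KM _ (subsetP BK _ bB)) bD ab.
    by apply/pred0Pn; exists b; rewrite /= bB TN.
  have nP x : x \in B -> x \notin cover P.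
    by move=> xB; have /pred0P/(_ x) := dB; rewrite /= xB => /negbT.
  (* Otherwise [B] lies in a component of [K :\: S], which is active by upward closure and hence
     inside a child. *)
  apply/negP => dBT; have BKS : B \subset K :\: S.
    apply/subsetP => x xB; rewrite inE (subsetP BK) // andbT -TN ?nP //.
    by have /pred0P/(_ x) := dBT; rewrite /= xB => /negbT.
  have [C CS BC] := connected_in_component cB BKS.
  have aC : active C by split=> //; apply: uF FB.
  have [D DP CD] := child_max M r0 aC; apply: nBD; exists D => //.
  by apply: subset_trans BC (subset_trans _ CD); apply: sub_fill activeP _ aC.
- split=> [x y xK yK xy|x xK /touchP[y [_ [yR /set1P -> yx]]]].
    have [/bigcupP[D DP yD]|/levN -> //] := boolP (y \in cover P).
    rewrite (levE D y) //; have [_ _ [l1 l2] _] := solP D DP.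
    have [xD|xD] := boolP (x \in D).
      by rewrite (levE D x) // (TD D) // ltnS => lt; have [<- ->] := l1 _ _ xD yD xy lt.
    have yx : edge y x by rewrite edge_sym.
    have xM := subsetP KM _ xK.
    have [xS _ xP] := edgeP _ _ _ DP yD xM xD yx.
    rewrite levN // TN // xS l2 //; apply/touchP; exists x, y.
    by rewrite !inE xD xM.
  apply: levN; apply/negP => /bigcupP[D DP xD].
  have xy : edge x y by rewrite edge_sym.
  have /setDP[yM yK] := yR.
  have yD : y \notin D by apply: contra yK; apply: (subsetP (subP D DP)).
  by have [_ yK' _] := edgeP _ _ _ DP xD yM yD xy; rewrite yK' in yK.
move=> u uK.
have reachN v : v \notin cover P -> v \in wreach N K T rho u ->
    v \in wreach N K (S :\: cover P) rho0 u.
  move=> vP /wreachP[vT wlk]; apply/wreachP; split; first by rewrite inE vP -TN.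
  have rv : rho v = rho0 v by rewrite /rho (negbTE vP).
  apply: walk_sub wlk => [|x _ /setDP[xS xP]]; last by rewrite TN.
  apply/subsetP => x /aboveP[xK xm]; apply/aboveP; split=> // /setDP[xS xP].
  by move: xm; rewrite TN // rv /rho (negbTE xP); apply.
have reachD D v : D \in P -> v \in D -> v \in wreach N K T rho u ->
    u \in D /\ v \in wreach N D (SD D) (rhoD D) u.
  move=> DP vD /wreachP[vT wlk]; set Q := above _ _ _ _ in wlk.
  have QS x : x \in Q -> x \notin cover P -> x \notin S.
    move=> /aboveP[xK xm] xP; apply/negP => xS; have := xm.
    rewrite TN // (rhoE D v) // => /(_ xS); apply/negP; rewrite -ltnNge.
    exact: leq_trans (rhoN _ xP) (leq_addr _ _).
  have QK x : x \in Q -> x \in K by case/aboveP.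
  have [/bigcupP[E EP uE]|uP] := boolP (u \in cover P); last first.
    have clos x y : x \in ~: cover P -> x \in Q -> y \in Q -> edge x y -> y \in ~: cover P.
      rewrite !in_setC => xP xQ yQ xy; apply/negP => /bigcupP[E EP yE].
      have xE : x \notin E by apply: contra xP; apply: covE.
      have yx : edge y x by rewrite edge_sym.
      have [xS _ _] := edgeP _ _ _ EP yE (subsetP KM _ (QK _ xQ)) xE yx.
      by have := QS x xQ xP; rewrite xS.
    have uC : u \in ~: cover P by rewrite in_setC.
    by have := walk_end (walk_restrict clos wlk uC); rewrite in_setI in_setC (covE D) ?andbF.
  have clos x y : x \in E -> x \in Q -> y \in Q -> edge x y -> y \in E.
    move=> xE xQ yQ xy; apply: contrapT => /negP yE.
    have [yS _ yP] := edgeP _ _ _ EP xE (subsetP KM _ (QK _ yQ)) yE xy.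
    by have := QS y yQ yP; rewrite yS.
  have {}wlk := walk_restrict clos wlk uE; have /setIP[_ vE] := walk_end wlk.
  have ED : E = D by rewrite -(blkE E v) // (blkE D v).
  subst E; split=> //; apply/wreachP; split; first by rewrite -(TD D).
  have QD : Q :&: D \subset D by apply: subsetIr.
  apply: walk_sub wlk => [|x /setIP[xQ xD]]; last by rewrite (TD D).
  apply/subsetP => x /setIP[/aboveP[xK xm] xD]; apply/aboveP; split=> // xSD.
  by move: xm; rewrite (TD D) // (rhoE D v) // (rhoE D x) // leq_add2l; apply.
split=> [v vu|i].
  have [/bigcupP[D DP vD]|/levN -> //] := boolP (v \in cover P).
  have [uD vu'] := reachD D v DP vD vu; rewrite !(levE D) // ltnS.
  by have [_ _ _ /(_ u uD)[lD _]] := solP D DP; apply: lD.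
case: i => [|i].
  apply: leq_trans (b0 u uK); apply: subset_leq_card; apply/subsetP => v.
  rewrite inE => /andP[vu]; have [/bigcupP[D DP vD]|vP _] := boolP (v \in cover P).
    by rewrite (levE D).
  exact: reachN.
have [/bigcupP[D DP uD]|uP] := boolP (u \in cover P).
  have [sub _ _ /(_ u uD)[_ /(_ i) cDi]] := solP D DP; apply: leq_trans cDi.
  apply: subset_leq_card; apply/subsetP => v; rewrite in_set => /andP[vu lv].
  have [/bigcupP[E EP vE]|/levN lv0] := boolP (v \in cover P); last by rewrite lv0 in lv.
  have [uE] := reachD E v EP vE vu.
  have -> : E = D by rewrite -(blkE E u) // (blkE D u).
  move=> vu'; have /wreachP[vS wlk] := vu'; rewrite in_set vu' /=.
  by move: lv; rewrite (levE D v) // (subsetP sub).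
apply: leq_trans (leq0n c); rewrite leqn0 cards_eq0; apply/eqP/setP => v.
rewrite in_set in_set0; apply/negP => /andP[vu lv].
have [/bigcupP[E EP vE]|/levN lv0] := boolP (v \in cover P); last by rewrite lv0 in lv.
have [uE _] := reachD E v EP vE vu.
by rewrite (covE E) in uP.
Qed.

Lemma solvable_no_rich_step : solvable N F M (1 + N.+1 * c).
Proof.
have [v0 v0M] := connected_nonempty cM.
(* Deleting one vertex gives every component a nonempty connected complement in [M], the first root;
   this is the summand 1. *)
apply: (@solvable_components _ _ _ _ [set v0]); first by rewrite sub1set.
  by apply: bounded_card; rewrite cards1.
move=> C CM; have cC := components_connected CM.
have CsM : C \subset M := subset_trans (components_sub CM) (subsetDl _ _).
have cMC : connected_set (M :\: C).
  have /imsetP[x _ ->] := CM; apply: connected_setD_component => //.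
    exact: connected_set1.
  by rewrite sub1set.
have [S [rho [lev [SC hS levP reachP]]]] := tree_levels CsM cC cMC.
exists S => //; split=> //; exists rho => u uC; have [le classes] := reachP u uC.
(* Only levels from [lev u - N] to [lev u] are reached: at most [N.+1] of them, with at most [c]
   vertices on each. *)
apply: (@card_leq_classes _ _ (fun v => lev u - lev v)) => [v vu|k].
  have /wreachP[_ wlk] := vu.
  have sub : above C S rho (rho v) \subset C by apply/subsetP => x /aboveP[].
  by have := walk_lev_descent levP sub wlk; lia.
have [ku|ku] := leqP k (lev u).
  apply: leq_trans (classes (lev u - k)); apply: subset_leq_card; apply/subsetP => v.
  by rewrite in_set => /andP[vu /eqP kv]; rewrite in_set vu; have := le v vu; lia.
apply: leq_trans (leq0n c); rewrite leqn0 cards_eq0; apply/eqP/setP => v.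
by rewrite in_set in_set0; apply/negP => /andP[_]; lia.
Qed.

End TreeStep.

(** * Excluding a rich star *)

(** The ruler sequence 0, 1, 0, 2, 0, 1, 0, 3, ... capped at [L]; the shift avoids the valuation of
    zero. *)
Definition ruler L i := minn L (logn 2 i.+1).

(** Below the cap, [a.+1] and [b.+1] are distinct odd multiples of the same power of two, and the
    even multiple after [a.+1] lies between them. At the cap both are multiples of [2 ^ L]. *)
Lemma ruler_gap L a b : a < b -> ruler L a = ruler L b ->
  (exists2 k, a < k < b & ruler L a < ruler L k) \/ a + 2 ^ L <= b.
Proof.
move=> ab; rewrite /ruler => e.
have dvd p n : (2 ^ p %| n.+1) = (p <= logn 2 n.+1) by rewrite pfactor_dvdn.
have [Lb|bL] := leqP L (logn 2 b.+1).
  right; have La : L <= logn 2 a.+1 by lia.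
  have : 2 ^ L %| b.+1 - a.+1 by rewrite dvdn_sub // dvd.
  by move/dvdn_leq; lia.
left; have eab : logn 2 a.+1 = logn 2 b.+1 by lia.
set p := logn 2 b.+1 in bL eab.
have /dvdnP[x ax] : 2 ^ p %| a.+1 by rewrite dvd eab.
have /dvdnP[y bY] : 2 ^ p %| b.+1 by rewrite dvd.
have p0 : 0 < 2 ^ p by rewrite expn_gt0.
have oddx : odd x.
  apply: contraT; rewrite -dvdn2 => /dvdnP[z xz].
  have : 2 ^ p.+1 %| a.+1 by apply/dvdnP; exists z; rewrite ax xz expnS mulnA.
  by rewrite dvd eab ltnn.
have oddy : odd y.
  apply: contraT; rewrite -dvdn2 => /dvdnP[z yz].
  have : 2 ^ p.+1 %| b.+1 by apply/dvdnP; exists z; rewrite bY yz expnS mulnA.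
  by rewrite dvd ltnn.
have xy : x < y by rewrite -(ltn_pmul2r p0) -ax -bY.
have xy2 : x.+1 < y by move: oddx oddy xy; lia.
have kE : (a + 2 ^ p).+1 = x.+1 * 2 ^ p by rewrite mulSn -ax; lia.
exists (a + 2 ^ p).
  by have : x.+1 * 2 ^ p < y * 2 ^ p; [rewrite ltn_pmul2r|rewrite -kE -bY; lia].
have : 2 ^ p.+1 %| (a + 2 ^ p).+1.
  rewrite kE expnS dvdn_pmul2r // dvdn2 /= negbK //.
by rewrite dvd; lia.
Qed.

Section Star.
Variable G : sgraph.
Implicit Types (B C D K R S : {set G}).

(* Levels are ordered by the ruler sequence, so that from [u] only the record
   levels below and above [u] are reached: at most one for each ruler value. *)
Lemma bounded_leveling N L K R S lev q : leveling K R S lev ->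
  (forall i, #|[set v in S | lev v == i]| <= q) -> N < 2 ^ L ->
  bounded N K S ((2 * L.+1) * q).
Proof.
move=> levP levq NL; pose e v := ruler L (lev v).
have eL v : e v <= L by rewrite /e /ruler geq_minl.
exists (fun v => L - e v) => u uK; set A := wreach _ _ _ _ _.
(* The order is by [L - e v], so large ruler values come first and block what lies behind them. *)
have cross v k : v \in A -> (lev v <= k < lev u) || (lev u <= k < lev v) ->
    ruler L k <= e v.
  move=> /wreachP[vS wlk] kP.
  have sub : above K S (fun v => L - e v) (L - e v) \subset K.
    by apply/subsetP => x /aboveP[].
  have [z [/aboveP[_ zm] zS zk]] := walk_lev_cross levP sub wlk kP.
  have ez : e z = ruler L k by rewrite /e zk.
  by have := zm zS; have := eL z; have := eL v; lia.
have dist v : v \in A -> lev u <= lev v + N /\ lev v <= lev u + N.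
  move=> /wreachP[vS wlk].
  have sub : above K S (fun v => L - e v) (L - e v) \subset K.
    by apply/subsetP => x /aboveP[].
  split; [exact: (walk_lev_descent levP sub wlk)|exact: (walk_lev_ascent levP sub wlk)].
(* Keys up to [L] serve the levels below [lev u], the next [L.+1] keys the others. Two levels with
   equal keys would either have a level of larger ruler value in between, which one of the walks
   crosses, or lie at least [2 ^ L], hence more than [N], apart. *)
pose key v := if lev v < lev u then e v else L.+1 + e v.
have key_inj v v' : v \in A -> v' \in A -> key v = key v' -> lev v <= lev v'.
  move=> vA v'A kk; rewrite leqNgt; apply/negP => lt.
  have l1 := eL v; have l2 := eL v'; have [d1 d2] := dist v vA; have [d3 d4] := dist v' v'A.
  have ee : e v' = e v.
    by move: kk; rewrite /key; case: (ltnP (lev v)); case: (ltnP (lev v')); lia.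
  have [[k kP ke]|] := ruler_gap lt ee; last first.
    by move: kk; rewrite /key; case: (ltnP (lev v)); case: (ltnP (lev v')); lia.
  have c1 := cross v k vA; have c2 := cross v' k v'A.
  rewrite -/(e v') in ke.
  by move: kk; rewrite /key; case: (ltnP (lev v)); case: (ltnP (lev v')); lia.
apply: (@card_leq_classes _ _ key) => [v vA|k].
  by rewrite /key; have l1 := eL v; case: (ltnP (lev v)); lia.
have [->|[v]] := set_0Vmem [set x in A | key x == k]; first by rewrite cards0.
rewrite in_set => /andP[vA /eqP vk]; apply: leq_trans (levq (lev v)).
apply: subset_leq_card; apply/subsetP => x; rewrite in_set => /andP[xA /eqP xk].
have /wreachP[xS _] := xA; rewrite in_set xS eqn_leq.
by rewrite !key_inj // ?xk ?vk.
Qed.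

(** * Chains of frontiers growing from a root *)

Section Chain.
Variables (F : {set G} -> Prop) (w N L d : nat).
Hypotheses (uF : upclosed F) (pc : packing_covering G w) (NL : N < 2 ^ L).

(** The centre may grow from [R] into [K], because successive roots of a chain absorb parts of
    [K]. *)
Definition star n R K : Prop :=
  exists s (R1 : {set G}), [/\ size s = n, disjoint_family s, connected_set R1,
    R \subset R1 /\ R1 \subset R :|: K &
    forall B, B \in s -> [/\ connected_set B, B \subset K, F B,
      [disjoint R1 & B] & touch R1 B]].

(** [q] bounds the vertices on one level, [ell] the levels reached in the ruler order. *)
Let q := d.+1 * w.
Let ell := 2 * L.+1.

Section Node.
Variables (R K Z : {set G}) (r0 : G).
Hypotheses (cR : connected_set R) (cK : connected_set K) (dRK : [disjoint R & K])
  (tRK : touch R K) (r0R : r0 \in R).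
Hypothesis hZ : forall B, [/\ connected_set B, B \subset K, F B & touch R B] ->
  ~~ [disjoint B & Z].

(** [root_side] is what [R] reaches without using [Z] inside [K]. Absorbing its frontier gives a
    connected next root, which the rest of [K] touches only in the frontier. *)
Definition root_side : {set G} := component_of (R :|: (K :\: Z)) r0.
Definition frontier : {set G} := [set z in Z :&: K | touch root_side [set z]].
Definition next_root : {set G} := root_side :|: frontier.
Definition beyond : {set G} := K :\: next_root.

Let notRK x : x \in R -> x \in K -> False.
Proof. by move=> xR xK; have /pred0P/(_ x) := dRK; rewrite /= xR xK. Qed.

Let r0_base : r0 \in R :|: (K :\: Z).
Proof. by rewrite inE r0R. Qed.

Lemma root_side_connected : connected_set root_side.
Proof. exact: component_of_connected. Qed.

Lemma sub_root_side : R \subset root_side.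
Proof.
apply: connected_sub_component => //; first exact: subsetUl.
by exists r0 => //; apply: mem_component_of.
Qed.

Lemma sub_next_root : R \subset next_root.
Proof. exact: subset_trans sub_root_side (subsetUl _ _). Qed.

Lemma next_root_connected : connected_set next_root.
Proof.
apply: connected_setU_points; first exact: root_side_connected.
by move=> z; rewrite inE => /andP[].
Qed.

Lemma frontier_sub : frontier \subset K.
Proof. by apply/subsetP => x; rewrite !inE => /andP[/andP[]]. Qed.

Lemma next_root_sub : next_root \subset R :|: K.
Proof.
rewrite subUset (subset_trans (component_of_sub _ _)) ?setUS ?subsetDl //=.
exact: subset_trans frontier_sub (subsetUr _ _).
Qed.

Lemma root_side_edge x y : x \in K -> y \in root_side -> edge x y -> x \in next_root.
Proof.
move=> xK yA xy; have yx : edge y x by rewrite edge_sym.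
rewrite inE; have [xZ|xZ] := boolP (x \in Z).
  apply/orP; right; rewrite !inE xZ xK /=; apply/touchP; exists y, x.
  by rewrite inE.
by rewrite (component_of_edge yA) // !inE xZ xK orbT.
Qed.

Lemma near_root_next x : x \in K -> touch R [set x] -> x \in next_root.
Proof.
move=> xK /touchP[y [_ [yR /set1P -> yx]]].
have yA := subsetP sub_root_side _ yR.
by apply: root_side_edge xK yA _; rewrite edge_sym.
Qed.

Lemma beyond_edge x y : x \in beyond -> y \in R :|: K -> y \notin beyond ->
  edge x y -> y \in frontier.
Proof.
move=> /setDP[xK xN] yRK yB xy.
have : y \in next_root.
  case/setUP: yRK => [/(subsetP sub_next_root) //|yK].
  by apply: contraR yB => yN; rewrite inE yN.
case/setUP => // yA; case/negP: xN; exact: root_side_edge xK yA xy.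
Qed.

Lemma beyond_component C : C \in components beyond ->
  [/\ connected_set C, C \subset K, [disjoint next_root & C] & touch next_root C].
Proof.
move=> CB; have cC := components_connected CB; have sC := components_sub CB.
have CK : C \subset K := subset_trans sC (subsetDl _ _).
split=> //.
  by move: sC; rewrite subsetD disjoint_sym => /andP[].
have RK_conn := connected_setU cR cK tRK.
have CRK : C \subset R :|: K := subset_trans CK (subsetUr _ _).
have : touch ((R :|: K) :\: C) C.
  apply: connected_touch_setD => //; first by case/andP: cC.
  apply/eqP => e; have : r0 \in C by rewrite e inE r0R.
  by move/(subsetP CK); apply: notRK.
move=> /touchP[y [x [/setDP[yRK yC] xC yx]]]; apply/touchP; exists y, x; split=> //.
have xy : edge x y by rewrite edge_sym.
rewrite inE (beyond_edge (subsetP sC _ xC) yRK _ xy) ?orbT //.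
by apply: contra yC => yB; apply: components_edge CB xC yB xy.
Qed.

(** If [D] is not beyond the frontier, it lies in [root_side]. A member of [F] inside it would then
    sit in a component of [K :\: Z] touching [R], which is in [F] by upward closure and misses [Z],
    against [hZ]. *)
Lemma frontier_components D : connected_set D -> D \subset K :\: frontier ->
  (forall B, connected_set B -> B \subset D -> ~ F B) \/
  (exists2 C, C \in components beyond & D \subset C).
Proof.
move=> cD; rewrite subsetD => /andP[DK dDf].
have [|nsub] := boolP (D \subset beyond); first by right; apply: connected_in_component.
left=> B cB BD FB.
have DB x : x \in D -> x \notin beyond.
  move=> xD; apply/negP => xB.
  have [|a [b [aD aB bD bB ab]]] := connected_cross cD _ nsub; first by exists x.
  have bRK : b \in R :|: K by rewrite inE (subsetP DK) ?orbT.
  have bf := beyond_edge aB bRK bB ab.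
  by have /pred0P/(_ b) := dDf; rewrite /= bD bf.
have DA : D \subset root_side.
  apply/subsetP => x xD; have := DB x xD; rewrite inE (subsetP DK) // andbT negbK.
  case/setUP => // xf; by have /pred0P/(_ x) := dDf; rewrite /= xD xf.
have DKZ : D \subset K :\: Z.
  apply/subsetP => x xD; have := subsetP (component_of_sub _ _) _ (subsetP DA _ xD).
  by case/setUP => // xR; case: (notRK xR); apply: (subsetP DK).
have [E EK BE] := connected_in_component cB (subset_trans BD DKZ).
have sE := components_sub EK; have [b bB] := connected_nonempty cB.
have [||x [y [xA xE yA yE xy]]] := connected_cross (C := E) root_side_connected.
- by exists b; [apply: (subsetP DA); apply: (subsetP BD)|apply: (subsetP BE)].
- apply/subsetPn; exists r0; first exact: mem_component_of.
  by apply/negP => /(subsetP sE) /setDP[r0K _]; apply: notRK r0K.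
have yR : y \in R.
  have := subsetP (component_of_sub _ _) _ yA; case/setUP => // yKZ.
  by case/negP: yE; apply: components_edge EK xE yKZ xy.
have/hZ/negP : [/\ connected_set E, E \subset K, F E & touch R E].
  split; [exact: components_connected EK| |exact: uF FB|].
    exact: subset_trans sE (subsetDl _ _).
  by apply/touchP; exists y, x; rewrite edge_sym.
by apply; move: sE; rewrite subsetD => /andP[].
Qed.

Lemma star_beyond n C : C \in components beyond -> star n next_root C -> star n R K.
Proof.
move=> CB [s [R1 [ss ds cR1 [sR1 R1s] sP]]]; have [_ CK _ _] := beyond_component CB.
exists s, R1; split=> //.
  split; first exact: subset_trans sub_next_root sR1.
  apply: subset_trans R1s _; rewrite subUset next_root_sub /=.
  exact: subset_trans CK (subsetUr _ _).
by move=> B /sP[cB BC FB dB tB]; split=> //; apply: subset_trans CK.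
Qed.

(** [C2] itself is the extra branch: it touches [next_root] and is disjoint from the star grown in
    [C1]. *)
Lemma star_beyond_cons n C1 C2 : C1 \in components beyond ->
  C2 \in components beyond -> C1 != C2 -> F C2 ->
  star n next_root C1 -> star n.+1 R K.
Proof.
move=> CB1 CB2 ne FC2 [s [R1 [ss ds cR1 [sR1 R1s] sP]]].
have [cC1 C1K dC1 tC1] := beyond_component CB1.
have [cC2 C2K dC2 tC2] := beyond_component CB2.
have d12 : [disjoint C1 & C2] by have/trivIsetP := trivIset_components beyond; apply.
exists (C2 :: s), R1; split=> //.
- by rewrite /= ss.
- rewrite /disjoint_family pairwise_cons; apply/andP; split=> //.
  apply/allP => B /sP[_ BC1 _ _ _]; rewrite disjoint_sym.
  exact: disjointWl BC1 d12.
- split; first exact: subset_trans sub_next_root sR1.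
  apply: subset_trans R1s _; rewrite subUset next_root_sub /=.
  exact: subset_trans C1K (subsetUr _ _).
move=> B; rewrite inE => /orP[/eqP ->|/sP[cB BC FB dB tB]]; last first.
  by split=> //; apply: subset_trans C1K.
split=> //; last exact: touch_sub tC2.
apply: disjointWl R1s _; apply/pred0P => x /=; apply/negP => /andP[/setUP[xN|x1] x2].
  by have /pred0P/(_ x) := dC2; rewrite /= xN x2.
by have /pred0P/(_ x) := d12; rewrite /= x1 x2.
Qed.

Lemma beyond_proper C : C \in components beyond -> #|C| < #|K|.
Proof.
move=> CB; have [_ CK dC _] := beyond_component CB.
apply: proper_card; rewrite properE CK /=; apply/negP => KC.
have /touchP[y [x [yR xK yx]]] := tRK.
have xN : x \in next_root.
  by apply: near_root_next => //; apply/touchP; exists y, x; rewrite inE.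
by have /pred0P/(_ x) := dC; rewrite /= xN (subsetP KC).
Qed.

End Node.

(** If a component [C1] beyond the frontier carries a star with [n.+1] branches, no other one
    contains a member of [F], by [star_beyond_cons]; so the levels continue in [C1] alone and form a
    chain. If there is no such component, the chain ends and [IHn] solves them all. *)
Let chain_levels n R K : n < d ->
  (forall R K, connected_set R -> connected_set K -> [disjoint R & K] ->
     touch R K -> ~ star n.+1 R K -> solvable N F K (n * (ell * q))) ->
  connected_set R -> connected_set K -> [disjoint R & K] -> touch R K ->
  ~ star n.+2 R K ->
  exists S lev, [/\ S \subset K, leveling K R S lev,
    forall i, #|[set v in S | lev v == i]| <= q &
    forall C, C \in components (K :\: S) -> solvable N F C (n * (ell * q))].
Proof.
move=> nd IHn; have [m leK] := ubnP #|K|; elim: m R K leK => // m IH R K leK.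
move=> cR cK dRK tRK nstar.
have [|[s [ss ds sP]]|[Z cZ hZ]] := pc n.+2
    (H := fun B => [/\ connected_set B, B \subset K, F B & touch R B]).
- by move=> B [].
- case: nstar; exists s, R; split=> //; first by split=> //; apply: subsetUl.
  by move=> B /sP[cB BK FB tB]; split=> //; apply: disjointWr BK dRK.
have [r0 r0R] := connected_nonempty cR.
pose R' := next_root R K Z r0; pose P := components (beyond R K Z r0).
pose Z0 := frontier R K Z r0.
have Z0K : Z0 \subset K := frontier_sub R K Z r0.
have compP C : C \in P ->
    [/\ connected_set C, C \subset K, [disjoint R' & C] & touch R' C].
  by move=> CP; apply: (beyond_component cR cK dRK tRK r0R CP).
have splitP D : connected_set D -> D \subset K :\: Z0 ->
    (forall B, connected_set B -> B \subset D -> ~ F B) \/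
    (exists2 C, C \in P & D \subset C).
  move=> cD DK; case: (frontier_components cR dRK r0R hZ cD DK) => [noF|[C CP DC]].
    by left.
  by right; exists C.
have cR' : connected_set R' := next_root_connected K Z r0R.
(* The cover has at most [n.+2 * w] vertices, and [n < d] gives [n.+2 <= d.+1]. *)
have cZ0 : #|Z0| <= q.
  have Z0Z : Z0 \subset Z by apply/subsetP => x; rewrite !inE => /andP[/andP[]].
  apply: leq_trans (subset_leq_card Z0Z) (leq_trans cZ _).
  by rewrite leq_mul2r ltnS nd orbT.
have [[C1 CP1 st1]|nst] := pselect (exists2 C, C \in P & star n.+1 R' C).
  have [cC1 C1K dC1 tC1] := compP C1 CP1.
  have nst1 : ~ star n.+2 R' C1.
    by move=> st; apply: nstar; exact: (star_beyond cR cK dRK tRK r0R CP1 st).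
  have ltC1 : #|C1| < m.
    apply: leq_trans (_ : #|K| <= m); last by rewrite -ltnS.
    exact: (beyond_proper cR cK dRK tRK r0R CP1).
  have [S1 [lev1 [S1C [l1 l2] lq sol1]]] := IH R' C1 ltC1 cR' cC1 dC1 tC1 nst1.
  pose lev x := if x \in C1 then (lev1 x).+1 else 0.
  have Z0C1 x : x \in Z0 -> x \notin C1.
    move=> xZ; have /pred0P/(_ x) := dC1; rewrite /= /R' in_setU xZ orbT /=.
    by move=> ->.
  exists (Z0 :|: S1), lev; split.
  - by rewrite subUset Z0K (subset_trans S1C).
  - split=> [x y xK yK xy|x xK tx]; last first.
      have xN : x \in R' by apply: (near_root_next Z cR r0R xK tx).
      by rewrite /lev; have /pred0P/(_ x) := dC1; rewrite /= xN /= => ->.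
    rewrite /lev; have [yC|//] := boolP (y \in C1).
    have [xC|xC _] := boolP (x \in C1).
      rewrite ltnS => lt; have [-> xS] := l1 _ _ xC yC xy lt.
      by rewrite inE xS orbT.
    have yx : edge y x by rewrite edge_sym.
    have xZ : x \in Z0.
      apply: (beyond_edge cR r0R (subsetP (components_sub CP1) _ yC) _ _ yx).
        by rewrite inE xK orbT.
      by apply: contra xC => xB; apply: components_edge CP1 yC xB yx.
    rewrite inE xZ l2 //; apply/touchP; exists x, y.
    by rewrite inE eqxx /R' in_setU xZ orbT.
  - case=> [|i].
      apply: leq_trans cZ0; apply: subset_leq_card; apply/subsetP => v.
      rewrite in_set => /andP[/setUP[//|vS]].
      by rewrite /lev (subsetP S1C).
    apply: leq_trans (lq i); apply: subset_leq_card; apply/subsetP => v.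
    rewrite in_set /lev => /andP[/setUP[/Z0C1/negbTE -> //|vS]].
    by rewrite in_set vS (subsetP S1C).
  move=> D DK; have cD := components_connected DK.
  have := components_sub DK; rewrite setDUr subsetI => /andP[DZ DS].
  have [noF|[C CP DC]] := splitP D cD DZ; first exact: solvable_void.
  have [eC|neC] := eqVneq C1 C.
    subst C; have DC1 : D \subset C1 :\: S1.
      by move: DS; rewrite !subsetD DC => /andP[].
    have [E EC DE] := connected_in_component cD DC1.
    by apply: solvable_sub DE (sol1 E EC).
  apply: solvable_void => B cB BD FB; apply: nstar.
  apply: (star_beyond_cons cR cK dRK tRK r0R CP1 CP neC _ st1).
  exact: uF (subset_trans BD DC) FB.
exists Z0, (fun=> 0); split=> //.
  case=> [|i]; last by rewrite (_ : [set _ in _ | _] = set0) ?cards0 //;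
    apply/setP => x; rewrite !inE andbF.
  by apply: leq_trans cZ0; apply: subset_leq_card; apply/subsetP => v; rewrite in_set => /andP[].
move=> D DK; have cD := components_connected DK; have DZ := components_sub DK.
have [noF|[C CP DC]] := splitP D cD DZ; first exact: solvable_void.
apply: solvable_sub DC _; have [cC CK dC tC] := compP C CP.
by apply: (IHn R') => // st; apply: nst; exists C.
Qed.

(** Each round pays [ell * q] for one chain and lowers by one the number of branches excluded in the
    remaining parts. With one branch excluded, [K] itself would be that branch. *)
Lemma solvable_no_star n R K : n <= d -> connected_set R -> connected_set K ->
  [disjoint R & K] -> touch R K -> ~ star n.+1 R K ->
  solvable N F K (n * (ell * q)).
Proof.
elim: n R K => [|n IH] R K nd cR cK dRK tRK nstar.
  apply: solvable_void => B cB BK FB; apply: nstar.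
  exists [:: K], R; split=> //; first by split=> //; apply: subsetUl.
  by move=> B'; rewrite inE => /eqP ->; split=> //; apply: uF FB.
have [|S [lev [SK levP lq sol]]] := @chain_levels n R K nd _ cR cK dRK tRK nstar.
  by move=> R1 K1; apply: IH; apply: ltnW.
rewrite mulSn; apply: solvable_components SK _ sol.
exact: bounded_leveling levP lq NL.
Qed.

(** The centre starts as a single vertex. Of the [d.+1] branches of a star, one is merged into the
    centre to make it satisfy [F]; the others are the leaves. *)
Lemma solvable_no_rich2 M : connected_set M -> ~ rich d 2 F M ->
  solvable N F M (1 + d * (2 * L.+1 * (d.+1 * w))).
Proof.
move=> cM nrich; have [v0 v0M] := connected_nonempty cM.
apply: (@solvable_components _ _ _ _ [set v0]); first by rewrite sub1set.
  by apply: bounded_card; rewrite cards1.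
move=> C CM; have cC := components_connected CM; have sC := components_sub CM.
have CsM : C \subset M := subset_trans sC (subsetDl _ _).
have v0C : v0 \notin C by apply/negP => /(subsetP sC); rewrite !inE eqxx.
have dC : [disjoint [set v0] & C] by rewrite disjoints1.
apply: (@solvable_no_star d [set v0]) => //; first exact: connected_set1.
  have : touch (M :\: C) C.
    apply: connected_touch_setD => //; first by case/andP: cC.
    by apply: contraNneq v0C => ->.
  move=> /touchP[y [x [/setDP[yM yC] xC yx]]]; apply/touchP; exists y, x; split=> //.
  rewrite inE; apply: contraR yC => yv0; apply: components_edge CM xC _ _.
    by rewrite !inE yv0.
  by rewrite edge_sym.
move=> [[|B0 s] [R1 [//= [ss] /andP[/allP dB0 ds] cR1 [sR1 R1s] sP]]].
have R1M : R1 \subset M.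
  by apply: subset_trans R1s _; rewrite subUset CsM sub1set v0M.
have [cB0 B0C FB0 dRB0 tB0] := sP B0 (mem_head _ _).
apply: nrich; exists (R1 :|: B0); split.
- by rewrite subUset R1M (subset_trans B0C CsM).
- exact: connected_setU.
- exact: uF (subsetUr _ _) FB0.
exists s; split=> // B Bs; have [cB BC FB dRB tB] := sP B (mem_behead (s := B0 :: s) Bs).
split; last first.
  apply: (@rich1 _ d) => //; split=> //.
  by apply: touch_sub tB => //; apply: subsetUl.
rewrite subsetD (subset_trans BC CsM) disjoint_sym /=; apply/pred0P => x /=.
apply/negP => /andP[/setUP[xR|x0] xB].
  by have /pred0P/(_ x) := dRB; rewrite /= xR xB.
by have /pred0P/(_ x) := dB0 B Bs; rewrite /= xB x0.
Qed.

End Chain.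

End Star.

(** * Treedepth and rich models *)

Section TreedepthModel.
Variable X : sgraph.
Implicit Types A C : {set X}.

Lemma components_connected_set A C : connected_set A -> C \in components A -> C = A.
Proof.
move=> cA CA; apply/eqP; rewrite eqEsubset components_sub //=.
apply: (connected_sub_components cA _ CA) => //.
have [x xC] := connected_nonempty (components_connected CA).
by exists x => //; apply: (subsetP (components_sub CA)).
Qed.

Lemma td_component A C : C \in components A -> td_in C <= td_in A.
Proof.
move=> CA; have [/components_connected_set/(_ CA) -> //|nA] := boolP (connected_set A).
rewrite (td_disconnected _ nA); first exact: (leq_bigmax_cond (F := fun C => td_in C)).
have [x xC] := connected_nonempty (components_connected CA).
by apply/set0Pn; exists x; apply: (subsetP (components_sub CA)).
Qed.

Lemma td_in_eq0 A : td_in A = 0 -> A = set0.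
Proof.
move=> tA; apply/eqP; apply: contraT => /set0Pn[x xA].
have CA := mem_components xA; have cC := components_connected CA.
have [[v _ e] _] := td_connected cC.
by have := td_component CA; rewrite tA e.
Qed.

(** Each component of [A] gets its own copy. A vertex [v] whose deletion lowers the treedepth goes
    to the root [R], the rest recursively to the subtrees; since these branch sets satisfy [near R],
    all edges at [v] are realised. *)
Lemma rich_copies_model (G : sgraph) d h A (F : {set G} -> Prop) (K : {set G}) n :
  #|A| <= d -> #|A| <= n -> td_in A <= h -> rich_copies d n h F K ->
  exists B : X -> {set G},
    [/\ forall x, x \in A -> [/\ connected_set (B x), B x \subset K & F (B x)],
        forall x y, x \in A -> y \in A -> x != y -> [disjoint B x & B y] &
        forall x y, x \in A -> y \in A -> edge x y -> touch (B x) (B y)].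
Proof.
elim: h A F K n => [|h IH] A F K n Ad An tA [s [ss ds sP]].
  move: tA; rewrite leqn0 => /eqP/td_in_eq0 ->.
  by exists (fun=> set0); split=> x; rewrite inE.
pose f C := nth set0 s (index C (enum (components A))).
have ltC C : C \in components A -> index C (enum (components A)) < size s.
  move=> CA; have cA : #|components A| <= n := leq_trans (leq_imset_card _ _) An.
  by rewrite ss; apply: leq_trans cA; rewrite [#|_|]cardE index_mem mem_enum.
have fs C : C \in components A -> f C \in s by move=> CA; apply: mem_nth; apply: ltC.
have fD C D : C \in components A -> D \in components A -> C != D -> [disjoint f C & f D].
  move=> CA DA ne.
  have neI : index C (enum (components A)) != index D (enum (components A)).
    by apply: contra ne => /eqP/index_inj -> //; rewrite mem_enum.
  have /(pairwiseP set0) pw := ds; move: neI; rewrite neq_ltn => /orP[lt|lt].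
    by apply: pw => //; apply: ltC.
  by rewrite disjoint_sym; apply: pw => //; apply: ltC.
have /choice[B BP] C : exists B : X -> {set G}, C \in components A ->
    [/\ forall x, x \in C -> [/\ connected_set (B x), B x \subset f C & F (B x)],
        forall x y, x \in C -> y \in C -> x != y -> [disjoint B x & B y] &
        forall x y, x \in C -> y \in C -> edge x y -> touch (B x) (B y)].
  have [CA|] := boolP (C \in components A); last by exists (fun=> set0).
  have CsA := subset_leq_card (components_sub CA).
  have [[v vC e] _] := td_connected (components_connected CA).
  have tC : td_in (C :\ v) <= h by have := td_component CA; rewrite e; lia.
  have lC : #|C :\ v| <= d.
    apply: leq_trans (leq_trans CsA Ad).
    by apply: subset_leq_card; apply: subD1set.
  have [fK [R [RC cR FR cop]]] := sP _ (fs C CA).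
  have [B1 [B1P B1D B1E]] := IH _ (near R F) (f C :\: R) d lC lC tC cop.
  exists (fun x => if x == v then R else B1 x) => _.
  have inC x : x \in C -> x != v -> x \in C :\ v by move=> xC xv; rewrite !inE xv.
  split=> [x xC|x y xC yC xy|x y xC yC xy].
  - have [//|xv] := eqVneq x v; have [c1 s1 [F1 _]] := B1P x (inC x xC xv).
    by split=> //; apply: subset_trans s1 (subsetDl _ _).
  - have disR z : z \in C -> z != v -> [disjoint R & B1 z].
      move=> zC zv; have [_ + _] := B1P z (inC z zC zv).
      by rewrite subsetD disjoint_sym => /andP[].
    have [xv|xv] := eqVneq x v; have [yv|yv] := eqVneq y v.
    + by rewrite xv yv eqxx in xy.
    + exact: disR.
    + by rewrite disjoint_sym; apply: disR.
    + by apply: B1D => //; apply: inC.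
  have tR z : z \in C -> z != v -> touch R (B1 z).
    by move=> zC zv; have [_ _ []] := B1P z (inC z zC zv).
  have [xv|xv] := eqVneq x v; have [yv|yv] := eqVneq y v.
  - by rewrite xv yv edge_irrefl in xy.
  - exact: tR.
  - have /touchP[a [b [aR bB ab]]] := tR x xC xv.
    by apply/touchP; exists b, a; rewrite edge_sym.
  - by apply: B1E => //; apply: inC.
pose comp := component_of A.
have cA x : x \in A -> comp x \in components A /\ x \in comp x.
  by move=> xA; split; [apply: mem_components|apply: mem_component_of].
exists (fun x => B (comp x) x); split=> [x xA|x y xA yA xy|x y xA yA xy].
- have [CA xC] := cA x xA; have [/(_ x xC)[c1 s1 F1] _ _] := BP _ CA.
  by split=> //; apply: subset_trans s1 _; have [] := sP _ (fs _ CA).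
- have [CA xC] := cA x xA; have [DA yD] := cA y yA.
  have [e|ne] := eqVneq (comp x) (comp y).
    by have [_ + _] := BP _ CA; rewrite -e; apply => //; rewrite e.
  have [/(_ x xC)[_ s1 _] _ _] := BP _ CA; have [/(_ y yD)[_ s2 _] _ _] := BP _ DA.
  by apply: disjointWl s1 (disjointWr s2 _); apply: fD.
have [CA xC] := cA x xA.
have yC : y \in comp x by apply: component_of_edge xC yA xy.
have -> : comp y = comp x by apply: component_of_eq.
by have [_ _] := BP _ CA; apply.
Qed.

End TreedepthModel.

Lemma minor_of_rich_copies (X G : sgraph) h : td X <= h ->
  rich_copies #|X| #|X| h (fun=> True) [set: G] -> is_minor X G.
Proof.
move=> tX cop; have cX : #|[set: X]| <= #|X| by rewrite cardsT.
have [B [BP BD BE]] := rich_copies_model cX cX tX cop.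
exists B; split=> [x|x y xy|x y xy]; first by have [] := BP x (in_setT _).
  exact: BD.
by apply/touchP; apply: BE.
Qed.

(** * Orderings *)

(** Sorting by [rho] gives the ordering. A path with at most [r] edges visits at most [r.+1]
    vertices, whence the budget. *)
Lemma wcol_bounded (G : sgraph) r c :
  bounded r.+1 [set: G] [set: G] c -> wcol G r <= c.
Proof.
move=> [rho b]; pose le x y := rho x <= rho y.
have le_total : total le by move=> x y; apply: leq_total.
have le_trans : transitive le by move=> y x z; apply: leq_trans.
have sz : size (sort le (enum G)) == #|G| by rewrite size_sort -cardE.
pose s : #|G|.-tuple G := Tuple sz.
have us : uniq s by rewrite sort_uniq enum_uniq.
rewrite /wcol; case: arg_minnP => [|s0 _ /(_ s us) min0]; first exact: enum_uniq.
apply: leq_trans min0 _; apply/bigmax_leqP => u _.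
apply: leq_trans (b u (in_setT u)); apply: subset_leq_card; apply/subsetP => v.
rewrite inE => /existsP[n /existsP[p /and4P[pth _ /eqP <- /allP al]]].
apply/wreachP; split; first exact: in_setT.
apply: (@walk_leq _ _ _ (size p).+1); last by rewrite size_tuple.
apply: path_walk => //; apply/allP => x xp; apply/aboveP; split; first exact: in_setT.
move=> _; have ins y : y \in (s : seq G) by rewrite mem_sort mem_enum.
apply: (sorted_leq_index le_trans (fun x => leqnn _) (sort_sorted le_total (enum G))).
- exact: ins.
- exact: ins.
exact: al.
Qed.

(** * The bound *)

Lemma solvable_no_rich_copies d h n : exists C : nat,
  forall (G : sgraph) w r (F : {set G} -> Prop) (K : {set G}),
  packing_covering G w -> 0 < w -> 0 < r -> upclosed F ->
  ~ rich_copies d n h.+2 F K ->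
  solvable r.+1 F K (C * (w * r ^ h * (trunc_log 2 r.+1).+2)).
Proof.
elim: h n => [|h IH] n.
  exists (n + 1 + d * (2 * d.+1)) => G w r F K pc w0 r0 uF ncop.
  (* [L = (trunc_log 2 r.+1).+1] ensures [r.+1 < 2 ^ L], and [ell] is [L.+1]. *)
  set ell := (trunc_log 2 r.+1).+2; rewrite expn0 muln1.
  apply: (@solvable_leq _ _ _ _ (n * w + (1 + d * (2 * ell * (d.+1 * w))))); last first.
    apply: (solvable_no_copies pc) ncop => C cC nrich.
    by apply: solvable_no_rich2 => //; apply: trunc_log_ltn.
  have -> : (n + 1 + d * (2 * d.+1)) * (w * ell) =
      n * (w * ell) + (w * ell + d * (2 * ell * (d.+1 * w))) by lia.
  apply: leq_add; first by rewrite leq_mul2l leq_pmulr ?orbT.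
  by rewrite leq_add2r muln_gt0 w0.
(* The step excludes [d.+1] copies, whatever [n] is. Its factor [N.+1 = r.+2] is at most [3 * r]
   since [0 < r]. *)
have [C CP] := IH d.+1; exists (n + 1 + 3 * C) => G w r F K pc w0 r0 uF ncop.
set ell := (trunc_log 2 r.+1).+2.
set m := w * r ^ h * ell.
have -> : w * r ^ h.+1 * ell = r * m by rewrite /m expnS; lia.
have m0 : w <= m by rewrite /m -mulnA leq_pmulr // muln_gt0 expn_gt0 r0.
apply: (@solvable_leq _ _ _ _ (n * w + (1 + r.+2 * (C * m)))); last first.
  apply: (solvable_no_copies pc) ncop => D cD nrich.
  apply: (solvable_no_rich_step uF cD nrich) => F' K' uF' ncop'.
  exact: CP.
have rm : m <= r * m by rewrite leq_pmull.
have -> : (n + 1 + 3 * C) * (r * m) = n * (r * m) + (r * m + 3 * r * (C * m)) by lia.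
apply: leq_add; first by rewrite leq_mul2l (leq_trans m0) ?orbT.
apply: leq_add; first by rewrite (leq_trans w0) ?(leq_trans m0).
by rewrite leq_mul2r; apply/orP; right; lia.
Qed.

Lemma wcol_minor_free t X : 2 <= t -> td X <= t ->
  exists C : nat, forall (G T : sgraph) (W : T -> {set G}),
  tree_decomposition W -> minor_free X G -> forall r, 0 < r ->
  wcol G r <= C * ((\max_x #|W x|) * r ^ (t - 2) * (trunc_log 2 r.+1).+2).
Proof.
move=> t2 tX; have [C CP] := solvable_no_rich_copies #|X| (t - 2) #|X|.
exists C => G T W tdW free r r0; set w := \max_x _.
have bagW x : #|W x| <= w by apply: leq_bigmax.
have pc : packing_covering G w by move=> n H; apply: (erdos_posa tdW bagW).
(* If all bags are empty, [G] is the null graph. *)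
have [w0|] := posnP w.
  apply: leq_trans (leq0n _); apply: wcol_bounded; apply: bounded_card.
  rewrite leqn0 cards_eq0; apply/eqP/setP => v; exfalso.
  have [_ cW _] := tdW; have [x] := connected_nonempty (cW v); rewrite inE => vW.
  have := bagW x; rewrite w0 leqn0 cards_eq0 => /eqP Wx0.
  by rewrite Wx0 inE in vW.
move=> w0; have [//||S _ [hS bS]] := CP G w r (fun=> True) setT pc w0 r0.
  have -> : (t - 2).+2 = t by lia.
  by move=> cop; apply: free (minor_of_rich_copies tX cop).
(* All singletons have to be hit, so [S] is the whole vertex set. *)
apply: wcol_bounded; suff eS : S = setT by rewrite eS in bS.
apply/setP => v; rewrite in_setT.
by have /pred0Pn[x /andP[/= /set1P -> ->]] := hS [set v] (connected_set1 v) (subsetT _) I.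
Qed.

(** * From the binary to the natural logarithm *)

Import Order.TTheory GRing.Theory Num.Theory.
Local Open Scope ring_scope.

Lemma trunc_log2_ln (R : realType) : exists m : nat, forall r, (2 <= r)%N ->
  ((trunc_log 2 r.+1).+2)%:R <= m%:R * ln (r%:R : R).
Proof.
have ln2 : 0 < ln (2 : R) by rewrite ln_gt0 // ltr1n.
(* For [2 <= r], [2 ^ k <= r.+1 <= r ^ 2] bounds [k * ln 2] by [2 * ln r], and the two extra units
   cost at most another [2 * ln r]. *)
exists (4 * Num.bound (ln (2 : R))^-1)%N => r r2.
set b := Num.bound _; set k := trunc_log _ _.
have bP : (ln (2 : R))^-1 <= b%:R.
  by apply/ltW/archi_boundP; rewrite invr_ge0 ltW.
have r0 : 0 < (r%:R : R) by rewrite ltr0n; apply: leq_trans r2.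
have lnr : ln 2 <= ln (r%:R : R) by rewrite ler_ln ?posrE // ler_nat.
have kP : k%:R * ln 2 <= 2 * ln (r%:R : R).
  rewrite !mulr_natl -!lnXn // ler_ln ?posrE ?exprn_gt0 //.
  rewrite -!natrX ler_nat; apply: leq_trans (trunc_logP _ _) _ => //.
  by rewrite -mulnn; nia.
have : (k.+2)%:R * ln 2 <= 4 * ln (r%:R : R).
  by rewrite -addn2 natrD mulrDl; move: kP lnr; lra.
rewrite -ler_pdivlMr // => /le_trans; apply.
rewrite natrM -[X in _ <= X]mulrA [b%:R * _]mulrC mulrA ler_wpM2l //.
by rewrite mulr_ge0 // (le_trans (ltW ln2)).
Qed.

Theorem theorem2 (R : realType) (t : nat) (ht : (2 <= t)%N)
    (X : sgraph) (hX : (td X <= t)%N) :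
  exists c : int, forall G : sgraph, minor_free X G ->
    forall r : nat, (2 <= r)%N ->
      (wcol G r)%:R <=
        c%:~R * (tw G + 1)%:~R * r%:R ^+ (t - 2) * ln (r%:R : R).
Proof.
have [C CP] := wcol_minor_free ht hX; have [m mP] := trunc_log2_ln R.
exists (C * m)%N%:Z => G free r r2; rewrite /tw subrK.
(* [tw G + 1] is the least possible largest bag size, attained by [T] and [W]. *)
case: ex_minnP => w /asboolP[T [W [tdW <-]]] _.
have := CP G T W tdW free r (ltnW r2); rewrite -(ler_nat R) => /le_trans; apply.
rewrite -!pmulrn !natrM natrX; set b := (\max_x _)%:R.
have -> : C%:R * m%:R * b * r%:R ^+ (t - 2) * ln r%:R =
    C%:R * (b * r%:R ^+ (t - 2) * (m%:R * ln (r%:R : R))) by ring.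
by rewrite !ler_wpM2l ?mulr_ge0 ?exprn_ge0 // mP.
Qed.
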